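(* Let $0<\sigma<1$ and let $c<\frac{\sigma(1-\sigma)}{4(7+3\sigma)}$. There exist an absolute constant $M\ge 0$ and a constant $\kappa>0$ depending only on $\sigma$ and $c$ such that the following holds. Let $0<\delta<1$, $C>0$, and let $A\subset[1,2]$ be a $\delta$-separated set of cardinality $\#A=\delta^{-\sigma}$. Suppose that for all intervals $I\subset\mathbb{R}$ of length $|I|\ge\delta$ we have $$\#(A\cap I)\leq C|I|^{\sigma}(\#A).$$ Then $$\mathcal{E}_\delta(A+A)+\mathcal{E}_\delta(A.A)\ \geq\ \kappa\, C^{-M}\,\delta^{-c}\,(\#A).$$
   Context: For $X\subset\mathbb{R}$ and $t>0$, $\mathcal{E}_t(X)$ denotes the $t$-covering number of $X$: the smallest number of intervals of length $t$ needed to cover $X$. A set $X\subset\mathbb{R}$ is $t$-separated if every pair of distinct points of $X$ has distance at least $t$. $\#X$ denotes cardinality. $A+A=\{a+a':a,a'\in A\}$ and $A.A=\{aa':a,a'\in A\}$. *)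

(* Defs.v *)
From HB Require Import structures.
From mathcomp Require Import all_boot all_order all_algebra finmap.
From mathcomp Require Import all_classical all_reals all_analysis.

Set Implicit Arguments.
Unset Strict Implicit.
Unset Printing Implicit Defensive.

Import Order.TTheory GRing.Theory Num.Theory.

Local Open Scope classical_set_scope.
Local Open Scope ring_scope.

(* Each endpoint may be open or closed. *)
Definition itv_of_length (R : realType) (I : interval R) (t : R) : Prop :=
  exists (a : R) (b1 b2 : bool), I = Interval (BSide b1 a) (BSide b2 (a + t)).

Definition covered_by (R : realType) (t : R) (X : set R) (n : nat) : Prop :=
  exists I : 'I_n -> interval R,
    (forall i, itv_of_length (I i) t) /\
    X `<=` \bigcup_(i in [set: 'I_n]) [set` I i].

(* An infimum of natural numbers, hence a minimum as soon as some finite cover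
   exists; it is +oo when X is unbounded. *)
Definition covering_number (R : realType) (t : R) (X : set R) : \bar R :=
  ereal_inf [set (n%:R)%:E | n in covered_by t X].

Definition separated_by (R : realType) (t : R) (X : set R) : Prop :=
  forall x y, X x -> X y -> x != y -> t <= `|x - y|.

Definition sumset (R : realType) (X Y : set R) : set R :=
  [set x + y | x in X & y in Y].

Definition productset (R : realType) (X Y : set R) : set R :=
  [set x * y | x in X & y in Y].

(* Main.v *)
Require Import Defs.
From HB Require Import structures.
From mathcomp Require Import all_boot all_order all_algebra finmap.
From mathcomp Require Import all_classical all_reals all_analysis.
From mathcomp Require Import ring lra zify.

(** Write N for the cardinality of A, K N for an upper bound of the sizes of A + A
    and A.A at scale delta, and P_a for the set of integer parts of a x / delta,
    x in A.  Everything is rounded to the grid of step delta, so that sums of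
    dilates of A become sums of finite sets of integers, up to bounded factors.

    A small product set gives an element b of A and a set A1 of elements a such
    that P_a and P_b have at least t common elements, where
    K l (t / N) (#A1 / N) >= 1 and l is a harmonic sum, hence essentially
    constant ([popular_dilate]).  The Ruzsa triangle inequalities through this
    intersection, together with the small sum set, give
    #(P_b +- P_a) <= k N with k = 16 K^2 N / t for a in A1 ([card_dilate_sums]).
    A Plunnecke inequality with base P_b then bounds the sum
    (a1 - a2) A + (a3 - a4) A, for a1, ..., a4 in A1, by k^4 N.  This sum has
    diameter of order d = a3 - a4, and the Plunnecke inequality may be localised
    to an interval of that length, where A has at most C d^sigma N points: the
    bound becomes k^4 C d^sigma N ([card_combo_floor]).

    Let B be the set of quotients (a1 - a2) / (a3 - a4) with a_i in A1 and
    a3 - a4 >= rho, and let eps = delta / rho^2.  If A1 has two points at distance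
    at least rho, which the Frostman condition ensures for small K, then B
    contains 0 and 1.  If moreover b / 2 and (b + 1) / 2 were within eps of B for
    every b in B between 0 and 1, then, by iteration, B would be 3 eps-dense in
    [0, 1] ([dense_of_halving]).  So one of two things happens.

    - B is dense.  Then one can choose about 1 / eps well-spaced quotients.  A
      quadruple of points of A whose first two coordinates are rho-separated can
      collide in x, y |-> b x + y for at most one of them, so on average there are
      few collisions, and by Cauchy-Schwarz some A + b A is large
      ([separated_quotients_bound]).  This gives K^12 >= rho^2 / (delta N) up to
      powers of C and l.

    - There is b in B such that c = b / 2 or c = (b + 1) / 2 is at distance at
      least eps from B.  Then all collisions of x, y |-> y + c x on A1 have first
      coordinates at distance less than rho, and the Frostman condition makes
      them rare: A1 + c A1 is large.  On the other hand 2 d (A1 + c A1) is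
      contained in the sum of (a1 - a2) A1 and of two or three copies of d A1,
      which is controlled by the previous bound, the additional copies of d A1
      costing only the square of the doubling constant of A1 at scale delta / d
      ([isolated_quotient_bound]).  This gives K^14 >= rho^(- sigma); the losses
      coming from N / t and from N / #A1 combine into the product that
      [popular_dilate] controls, which is why t is kept as a parameter.

    With rho = delta^g and g = 7 (1 - sigma) / (2 (7 + 3 sigma)) both cases say
    that K is at least delta^(- s), where
    s = sigma (1 - sigma) / (4 (7 + 3 sigma)), up to C^3 and l^8; and l is
    bounded by any negative power of delta, up to a constant. *)

Set Implicit Arguments.
Unset Strict Implicit.
Unset Printing Implicit Defensive.

Import Order.TTheory GRing.Theory Num.Theory.

Local Open Scope classical_set_scope.
Local Open Scope ring_scope.

(** * Sumsets of finite sets *)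

Definition fsum (V : zmodType) (X Y : {fset V}) : {fset V} :=
  [fset (x + y)%R | x in X, y in Y]%fset.

Definition fopp (V : zmodType) (X : {fset V}) : {fset V} :=
  [fset (- x)%R | x in X]%fset.

Notation "X +f Y" := (fsum X Y) (at level 50, left associativity).

Section Sumsets.
Local Open Scope fset_scope.
Local Open Scope ring_scope.
Variable V : zmodType.
Implicit Types (X Y Z W C S T : {fset V}).

Lemma fsumP X Y z :
  reflect (exists x y, [/\ x \in X, y \in Y & z = x + y]) (z \in X +f Y).
Proof.
apply: (iffP (imfset2P _ _ _ _ _)) => [[x /= xX [y /= yY ->]]|[x [y [xX yY ->]]]].
  by exists x, y.
by exists x => //; exists y.
Qed.

Lemma in_fsum X Y x y : x \in X -> y \in Y -> x + y \in X +f Y.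
Proof. by move=> xX yY; apply/fsumP; exists x, y. Qed.

Lemma fsumC X Y : X +f Y = Y +f X.
Proof.
by apply/fsetP => z; apply/fsumP/fsumP => -[x [y [xX yY ->]]];
  exists y, x; rewrite addrC.
Qed.

Lemma fsumA X Y Z : X +f (Y +f Z) = X +f Y +f Z.
Proof.
apply/fsetP => z; apply/fsumP/fsumP.
  move=> [x [_ [xX /fsumP[y [t [yY tZ ->]]] ->]]].
  by exists (x + y), t; rewrite addrA in_fsum.
move=> [_ [t [/fsumP[x [y [xX yY ->]]] tZ ->]]].
by exists x, (y + t); rewrite addrA in_fsum.
Qed.

Lemma fsumAC X Y Z : X +f Y +f Z = X +f Z +f Y.
Proof. by rewrite -!fsumA (fsumC Y). Qed.

Lemma fsumS X X' Y Y' :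
  X `<=` X' -> Y `<=` Y' -> X +f Y `<=` X' +f Y'.
Proof.
move=> /fsubsetP sX /fsubsetP sY; apply/fsubsetP => z /fsumP[x [y [xX yY ->]]].
by rewrite in_fsum ?sX ?sY.
Qed.

Lemma fsum0 X : X +f fset0 = fset0.
Proof. by apply/fsetP => z; rewrite inE; apply/fsumP => -[x [y []]]; rewrite inE. Qed.

Lemma fsum0l X : fset0 +f X = fset0.
Proof. by rewrite fsumC fsum0. Qed.

Lemma fsumX0 X : X +f [fset 0] = X.
Proof.
apply/fsetP => z; apply/fsumP/idP => [[x [_ [xX /fset1P-> ->]]]|zX].
  by rewrite addr0.
by exists z, 0; rewrite addr0 inE.
Qed.

Lemma fsumUl X Y C : (X `|` Y) +f C = (X +f C) `|` (Y +f C).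
Proof.
apply/fsetP => z; apply/fsumP/fsetUP.
  by move=> [x [y [/fsetUP[xX|xX] yY ->]]]; [left|right]; apply: in_fsum.
by move=> [] /fsumP[x [y [xX yY ->]]]; exists x, y; rewrite inE xX ?orbT.
Qed.

Lemma card_fsum1 X v : #|` X +f [fset v]| = #|` X|.
Proof.
have -> : X +f [fset v] = [fset (x + v)%R | x in X].
  apply/fsetP => z; apply/fsumP/imfsetP.
    by move=> [x [y [xX /fset1P-> ->]]]; exists x.
  by move=> [x /= xX ->]; exists x, v; rewrite inE.
by rewrite card_imfset //; apply: addIr.
Qed.

End Sumsets.

(** * Petridis's inequality and its consequences *)

Section Petridis.
Local Open Scope fset_scope.
Local Open Scope ring_scope.
Variables (R : realFieldType) (V : zmodType).
Implicit Types (X Y Z W C S T : {fset V}) (f : {fset V} -> R).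

Definition submodular f := forall S T, f (S `|` T) + f (S `&` T) <= f S + f T.

Definition translation_invariant f := forall S v, f (S +f [fset v]) = f S.

(** Petridis's argument: adding one point c to C, the union of X + c and X + C
    has intersection S + c with S a subset of X, and submodularity combined with
    the minimality of the ratio k on S propagates the inequality.  Only
    submodularity is used, so that one set X can be made to work for several
    summands at once by minimising a weighted sum. *)
Lemma petridis_ineq f X k :
  submodular f -> translation_invariant f -> f fset0 = 0 ->
  f X = k * #|` X|%:R ->
  (forall S, S `<=` X -> k * #|` S|%:R <= f S) ->
  forall C, f (X +f C) <= k * #|` X +f C|%:R.
Proof.
move=> fsub finv f0 fX fmin C.
have [n] := ubnP #|` C|; elim: n C => // n IHn C leC.
have [->|/fset0Pn[c cC]] := eqVneq C fset0.
  by rewrite fsum0 cardfs0 mulr0 f0.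
pose C0 := C `\ c.
have {}IH : f (X +f C0) <= k * #|` X +f C0|%:R.
  by apply: IHn; move: leC; rewrite (cardfsD1 c C) cC ltnS.
have -> : X +f C = (X +f [fset c]) `|` (X +f C0).
  by rewrite ![X +f _]fsumC -fsumUl fsetD1K.
pose S := [fset x in X | (x + c)%R \in X +f C0].
(* The part of X + c that was already covered is a translate of a subset of X,
   to which the minimality hypothesis applies. *)
have IE : (X +f [fset c]) `&` (X +f C0) = S +f [fset c].
  apply/fsetP => z; apply/fsetIP/fsumP.
    move=> [/fsumP[x [_ [xX /fset1P-> ->]]] zC].
    by exists x, c; rewrite !inE xX zC.
  move=> [x [_ [/[!inE]/= /andP[xX xC] /eqP-> ->]]]; split => //.
  by apply: in_fsum => //; rewrite inE.
have := fsub (X +f [fset c]) (X +f C0).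
rewrite IE !finv fX => sub.
have Smin : k * #|` S|%:R <= f S.
  by apply: fmin; apply/fsubsetP => x; rewrite !inE => /andP[].
have card : #|` (X +f [fset c]) `|` (X +f C0)|%:R
    = #|` X|%:R + #|` X +f C0|%:R - #|` S|%:R :> R.
  apply/eqP; rewrite eq_sym subr_eq -!natrD.
  by rewrite -(card_fsum1 S c) -IE cardfsUI card_fsum1.
rewrite card mulrBr mulrDr; lra.
Qed.

Lemma exists_min_ratio f X k :
  f fset0 = 0 -> X != fset0 -> f X <= k * #|` X|%:R ->
  exists X' k', [/\ X' `<=` X, X' != fset0, k' <= k, f X' = k' * #|` X'|%:R
    & forall S, S `<=` X' -> k' * #|` S|%:R <= f S].
Proof.
move=> f0; have [n] := ubnP #|` X|; elim: n X k => // n IHn X k leX X0 fX.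
have cX : 0 < #|` X|%:R :> R by rewrite ltr0n cardfs_gt0.
pose k' := f X / #|` X|%:R.
have fXE : f X = k' * #|` X|%:R by rewrite divfK ?gt_eqF.
have k'k : k' <= k by rewrite ler_pdivrMr.
have [Smin|] := pselect (forall S, S `<=` X -> k' * #|` S|%:R <= f S).
  by exists X, k'.
move=> /existsNP[S] /not_implyP[SX /negP]; rewrite -ltNge => fS.
have S0 : S != fset0.
  by apply: contraTneq fS => ->; rewrite f0 cardfs0 mulr0 ltxx.
have SltX : S `<` X.
  by rewrite fproperEneq SX andbT; apply: contraTneq fS => ->; rewrite fXE ltxx.
have [|X' [k2 [X'S X'0 lek2 fX' min']]] := IHn S k' _ S0 (ltW fS).
  by have := fproper_ltn_card SltX; lia.
exists X', k2; split => //; first exact: fsubset_trans X'S SX.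
exact: le_trans k'k.
Qed.

Lemma petridis f X k :
  submodular f -> translation_invariant f -> f fset0 = 0 ->
  X != fset0 -> f X <= k * #|` X|%:R ->
  exists X', [/\ X' `<=` X, X' != fset0
    & forall C, f (X' +f C) <= k * #|` X' +f C|%:R].
Proof.
move=> fsub finv f0 X0 fX.
have [X' [k' [X'X X'0 k'k fX' min']]] := exists_min_ratio f0 X0 fX.
exists X'; split => // C; apply: le_trans (petridis_ineq fsub finv f0 fX' min' C) _.
by rewrite ler_wpM2r.
Qed.

Lemma submodular_card_fsum B : submodular (fun S => #|` S +f B|%:R).
Proof.
move=> S T; rewrite -!natrD ler_nat fsumUl -[leqRHS]cardfsUI leq_add2l.
apply: fsubset_leq_card; rewrite fsubsetI; apply/andP.
by split; apply: fsumS; rewrite ?fsubset_refl ?fsubsetIl ?fsubsetIr.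
Qed.

Lemma translation_invariant_card_fsum B :
  translation_invariant (fun S => #|` S +f B|%:R).
Proof. by move=> S v; rewrite fsumAC card_fsum1. Qed.

Lemma petridis_one X B (k : R) :
  X != fset0 -> #|` X +f B|%:R <= k * #|` X|%:R ->
  exists X', [/\ X' `<=` X, X' != fset0
    & forall C, #|` X' +f C +f B|%:R <= k * #|` X' +f C|%:R].
Proof.
apply: (@petridis (fun S => #|` S +f B|%:R)).
- exact: submodular_card_fsum.
- exact: translation_invariant_card_fsum.
- by rewrite fsum0l cardfs0.
Qed.

Lemma card_fsum_ge X Y : Y != fset0 -> (#|` X| <= #|` X +f Y|)%N.
Proof.
move=> /fset0Pn[y yY]; rewrite -(card_fsum1 X y); apply: fsubset_leq_card.
by apply: fsumS; rewrite ?fsubset_refl// fsub1set.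
Qed.

Lemma fsum_neq0 X Y : X != fset0 -> Y != fset0 -> X +f Y != fset0.
Proof.
by move=> /fset0Pn[x xX] /fset0Pn[y yY]; apply/fset0Pn; exists (x + y); apply: in_fsum.
Qed.

(** Minimising k2 #(S + B1) + k1 #(S + B2) balances the two ratios, so that each
    of them is lost only up to a factor 2.  This replaces the product
    construction in the Plunnecke inequality with different summands. *)
Lemma petridis_two X B1 B2 (k1 k2 : R) : 0 < k1 -> 0 < k2 ->
  X != fset0 -> #|` X +f B1|%:R <= k1 * #|` X|%:R ->
  #|` X +f B2|%:R <= k2 * #|` X|%:R ->
  exists X', [/\ X' `<=` X, X' != fset0,
      forall C, #|` X' +f C +f B1|%:R <= 2 * k1 * #|` X' +f C|%:R
    & forall C, #|` X' +f C +f B2|%:R <= 2 * k2 * #|` X' +f C|%:R].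
Proof.
move=> k1_gt0 k2_gt0 X0 XB1 XB2.
pose f S : R := k2 * #|` S +f B1|%:R + k1 * #|` S +f B2|%:R.
have [|||||X' [X'X X'0 fX']] := @petridis f X (2 * k1 * k2).
- move=> S T; rewrite /f.
  have /(ler_wpM2l (ltW k2_gt0)) := submodular_card_fsum B1 S T.
  have /(ler_wpM2l (ltW k1_gt0)) := submodular_card_fsum B2 S T.
  by rewrite /= !mulrDr; lra.
- by move=> S v; rewrite /f !translation_invariant_card_fsum.
- by rewrite /f !fsum0l cardfs0 !mulr0 addr0.
- exact: X0.
- rewrite /f; move/(ler_wpM2l (ltW k2_gt0)): XB1.
  move/(ler_wpM2l (ltW k1_gt0)): XB2; lra.
exists X'; split => // C; have := fX' C; rewrite /f => h.
  rewrite -(@ler_pM2l _ k2)//.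
  have : 0 <= k1 * #|` X' +f C +f B2|%:R by rewrite mulr_ge0 ?ler0n ?ltW.
  lra.
rewrite -(@ler_pM2l _ k1)//.
have : 0 <= k2 * #|` X' +f C +f B1|%:R by rewrite mulr_ge0 ?ler0n ?ltW.
lra.
Qed.

(** The set produced by the Petridis inequality may be tiny.  Taking a disjoint
    union of such sets until it exhausts half of Z makes it large, since the
    required inequality is additive over disjoint unions. *)
Lemma plunnecke_large Z W (k1 k2 : R) : 0 < k1 -> 0 < k2 ->
  #|` Z +f Z|%:R <= k1 * #|` Z|%:R -> #|` Z +f W|%:R <= k2 * #|` Z|%:R ->
  exists Z', [/\ Z' `<=` Z, #|` Z|%:R <= 2 * #|` Z'|%:R :> R
    & #|` Z' +f Z +f Z +f W|%:R <= 64 * k1 ^+ 2 * k2 * #|` Z|%:R].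
Proof.
move=> k1_gt0 k2_gt0 ZZ ZW.
pose good Z' := #|` Z' +f Z +f Z +f W|%:R <= 64 * k1 ^+ 2 * k2 * #|` Z'|%:R.
have k_ge0 : 0 <= 64 * k1 ^+ 2 * k2 by rewrite !mulr_ge0 ?exprn_ge0 ?ler0n ?(ltW k1_gt0) ?(ltW k2_gt0).
suff: forall n Z', (#|` Z| - #|` Z'| < n)%N -> Z' `<=` Z -> good Z' ->
    exists2 Z', Z' `<=` Z & #|` Z|%:R <= 2 * #|` Z'|%:R :> R /\ good Z'.
  move=> /(_ #|` Z|.+1 fset0) []; rewrite ?fsub0set /good ?cardfs0 ?subn0//.
    by rewrite !fsum0l cardfs0 mulr0.
  move=> Z' Z'Z [Z'ge good']; exists Z'; split => //.
  by apply: le_trans good' _; rewrite ler_wpM2l ?ler_nat ?fsubset_leq_card.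
elim=> // n IHn Z' ltn Z'Z gZ'.
have [?|small] := leP (#|` Z|%:R : R) (2 * #|` Z'|%:R); first by exists Z'.
have Z'lt : (#|` Z'| < #|` Z|)%N.
  rewrite -(ltr_nat R); apply: le_lt_trans small.
  by rewrite mulr_natl mulr2n lerDl.
pose Y := Z `\` Z'.
have cY : #|` Y|%:R = #|` Z|%:R - #|` Z'|%:R :> R.
  by rewrite cardfsDS// natrB// ltnW.
have cY2 : #|` Z|%:R <= 2 * #|` Y|%:R :> R by rewrite cY; lra.
have YZ : Y `<=` Z by apply: fsubsetDl.
have Y0 : Y != fset0.
  by rewrite -cardfs_gt0 -(ltr_nat R) cY subr_gt0 ltr_nat.
have grow B (k : R) : 0 < k -> #|` Z +f B|%:R <= k * #|` Z|%:R ->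
    #|` Y +f B|%:R <= (2 * k) * #|` Y|%:R.
  move=> k_gt0 ZB; have : #|` Y +f B|%:R <= #|` Z +f B|%:R :> R.
    by rewrite ler_nat fsubset_leq_card// fsumS.
  by have := ler_wpM2l (ltW k_gt0) cY2; lra.
have [||X [XY X0 X1 X2]] := petridis_two _ _ Y0 (grow _ _ k1_gt0 ZZ) (grow _ _ k2_gt0 ZW).
- by rewrite mulr_gt0.
- by rewrite mulr_gt0.
(* Each of B1 = Z and B2 = W costs a factor 2 from the balancing and a factor 2
   from Y being only half of Z: 4^3 = 64. *)
have gX : good X.
  rewrite /good.
  have := X1 [fset 0]; have := X1 Z; have := X2 (Z +f Z).
  rewrite fsumX0 !fsumA => h1 h2 h3.
  apply: le_trans h1 _.
  have : 4 * k1 * #|` X +f Z|%:R <= 4 * k1 * (4 * k1 * #|` X|%:R).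
    by apply: ler_wpM2l; lra.
  move=> h4.
  have : #|` X +f Z +f Z|%:R <= 16 * k1 ^+ 2 * #|` X|%:R by lra.
  have k2_4 : 0 <= 4 * k2 by lra.
  by move=> /(ler_wpM2l k2_4); lra.
have disj : [disjoint Z' & X].
  apply/fdisjointP => z zZ'; apply: contraTN zZ' => /(fsubsetP XY).
  by rewrite inE => /andP[].
have cU : #|` Z' `|` X| = (#|` Z'| + #|` X|)%N.
  have := cardfsUI Z' X; move/disjoint_fsetI0: disj => ->.
  by rewrite cardfs0 addn0.
have UZ : Z' `|` X `<=` Z by rewrite fsubUset Z'Z (fsubset_trans XY).
apply: (IHn (Z' `|` X)) => //.
  have := fsubset_leq_card UZ; move: X0 ltn; rewrite -cardfs_gt0 cU.
  by move: #|` Z| #|` Z'| #|` X|; clear; lia.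
rewrite /good !fsumUl cU natrD mulrDr.
have le : #|` Z' +f Z +f Z +f W `|` (X +f Z +f Z +f W)|%:R
   <= #|` Z' +f Z +f Z +f W|%:R + #|` X +f Z +f Z +f W|%:R :> R.
  by rewrite -natrD ler_nat -[leqRHS]cardfsUI leq_addr.
by apply: le_trans le _; apply: lerD.
Qed.

End Petridis.

(** * Counting *)

Section Counting.
Local Open Scope fset_scope.
Local Open Scope ring_scope.

Lemma card_le_inj (T U : choiceType) (X : {fset T}) (Y : {fset U}) (f : T -> U) :
  {in X, forall x, f x \in Y} -> {in X &, injective f} -> (#|` X| <= #|` Y|)%N.
Proof.
move=> fXY finj; have <- : #|` [fset f x | x in X]| = #|` X|.
  by rewrite card_in_imfset.
by apply: fsubset_leq_card; apply/fsubsetP => _ /imfsetP[x /= xX ->]; apply: fXY.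
Qed.

Lemma card_sep_sum (T : choiceType) (A : {fset T}) (P : pred T) :
  #|` [fset x in A | P x]| = (\sum_(x <- A) P x)%N.
Proof.
by rewrite card_fset_sum1 -(big_fset_condE _ A P) -big_mkcond.
Qed.

Lemma cardfsM (T U : choiceType) (X : {fset T}) (Y : {fset U}) :
  #|` X `*` Y| = (#|` X| * #|` Y|)%N.
Proof.
rewrite (perm_size (enum_imfset2 _ _)) /=; last by move=> [? ?] [? ?] _ _ /= [-> ->].
by rewrite size_allpairs.
Qed.

(** The form in which rounding errors are absorbed: P is covered by m translates
    of the image of Q. *)
Lemma card_le_cover (P : {fset int}) (T : choiceType) (Q : {fset T})
    (h : T -> int) (m : nat) :
  (forall p, p \in P -> exists2 q, q \in Q & 0 <= p - h q < m%:Z) ->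
  (#|` P| <= m * #|` Q|)%N.
Proof.
have [->|/fset0Pn[p0 p0P] PQ] := eqVneq P fset0; first by rewrite cardfs0.
have [q0 _ _] := PQ p0 p0P.
have /choice[g gP] : forall p, exists q, p \in P -> q \in Q /\ 0 <= p - h q < m%:Z.
  move=> p; have [/PQ[q qQ hq]|pP] := boolP (p \in P); first by exists q.
  by exists q0.
have -> : (m * #|` Q| = #|` Q `*` [fset j in iota 0 m]|)%N.
  by rewrite cardfsM card_fseq undup_id ?iota_uniq// size_iota mulnC.
apply: (@card_le_inj _ _ _ _ (fun p => (g p, `|p - h (g p)|%N))) => [p pP|p q pP qP /=].
  have [gQ /andP[ge0 ltm]] := gP p pP.
  by rewrite !inE gQ mem_iota /=; lia.
have [_ /andP[p_ge _]] := gP p pP; have [_ /andP[q_ge _]] := gP q qP.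
by move=> [eg]; rewrite -eg in q_ge *; lia.
Qed.

Lemma double_count (R : numDomainType) (T U : choiceType)
    (X : {fset T}) (Y : {fset U}) (r : T -> U -> bool) (m k : R) :
  (forall x, x \in X -> m <= #|` [fset y in Y | r x y]|%:R) ->
  (forall y, y \in Y -> #|` [fset x in X | r x y]|%:R <= k) ->
  m * #|` X|%:R <= k * #|` Y|%:R.
Proof.
move=> Xm Yk.
have -> : m * #|` X|%:R = \sum_(x <- X) m.
  by rewrite big_const_seq count_predT iter_addr_0 mulr_natr.
have -> : k * #|` Y|%:R = \sum_(y <- Y) k.
  by rewrite big_const_seq count_predT iter_addr_0 mulr_natr.
have le1 : \sum_(x <- X) m <= (\sum_(x <- X) \sum_(y <- Y) r x y)%:R.
  rewrite natr_sum big_seq [leRHS]big_seq; apply: ler_sum => x xX.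
  by rewrite -card_sep_sum Xm.
have le2 : (\sum_(x <- X) \sum_(y <- Y) r x y)%:R <= \sum_(y <- Y) k.
  rewrite exchange_big natr_sum big_seq [leRHS]big_seq; apply: ler_sum => y yY.
  by rewrite -(card_sep_sum X (r^~ y)) Yk.
exact: le_trans le1 le2.
Qed.

Lemma sum_eq_mem (T : choiceType) (G : {fset T}) (g : T) :
  g \in G -> (\sum_(h <- G) (g == h) = 1)%N.
Proof.
move=> gG; rewrite (big_fsetD1 g)//= eqxx big1_seq// => h.
by rewrite !inE eq_sym => /andP[_ /andP[/negPf-> _]].
Qed.

Lemma sqr_sum_le (T : Type) (s : seq T) (m : T -> nat) :
  ((\sum_(i <- s) m i) ^ 2 <= size s * \sum_(i <- s) m i ^ 2)%N.
Proof.
rewrite -(leq_pmul2l (isT : 0 < 2)%N).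
have -> : (2 * (\sum_(i <- s) m i) ^ 2 = \sum_(i <- s) \sum_(j <- s) 2 * (m i * m j))%N.
  rewrite -mulnn big_distrlr big_distrr /=; apply: eq_bigr => i _.
  by rewrite big_distrr.
have -> : (2 * (size s * \sum_(i <- s) m i ^ 2)
    = \sum_(i <- s) \sum_(j <- s) (m i ^ 2 + m j ^ 2))%N.
  rewrite mul2n -addnn.
  under [RHS]eq_bigr do rewrite big_split /= big_const_seq count_predT iter_addn_0.
  by rewrite big_split /= -big_distrl /= big_const_seq count_predT iter_addn_0 mulnC.
by do 2 apply: leq_sum => ? _; rewrite nat_Cauchy.
Qed.

(** Cauchy-Schwarz over the fibres of f. *)
Lemma collision_seq (T U : choiceType) (s : seq T) (f : T -> U) (G : {fset U}) :
  (forall i, i \in s -> f i \in G) ->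
  (size s ^ 2 <= #|` G| * \sum_(i <- s) \sum_(j <- s) (f i == f j))%N.
Proof.
move=> fG; pose m g := (\sum_(i <- s) (f i == g))%N.
have -> : (size s = \sum_(g <- G) m g)%N.
  rewrite /m exchange_big /= -sum1_size big_seq [RHS]big_seq.
  by apply: eq_bigr => i si; rewrite sum_eq_mem// fG.
apply: leq_trans (sqr_sum_le _ _) _; rewrite leq_mul2l; apply/orP; right.
rewrite leq_eqVlt; apply/orP; left; apply/eqP.
rewrite /m.
under eq_bigr do rewrite -mulnn big_distrlr.
rewrite exchange_big big_seq [RHS]big_seq /=; apply: eq_bigr => i si.
rewrite exchange_big; apply: eq_bigr => j _ /=.
have [<-|ne] := eqVneq (f i) (f j).
  under eq_bigr do rewrite mulnb andbb.
  by rewrite sum_eq_mem// fG.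
rewrite big1_seq// => g _; rewrite mulnb.
by have [<-|//] := eqVneq (f i) g; rewrite eq_sym (negPf ne).
Qed.

Lemma collision (T T' U : choiceType) (X : {fset T}) (Y : {fset T'})
    (f : T -> T' -> U) (G : {fset U}) :
  (forall x y, x \in X -> y \in Y -> f x y \in G) ->
  ((#|` X| * #|` Y|) ^ 2 <= #|` G| *
    \sum_(x <- X) \sum_(y <- Y) \sum_(x' <- X) \sum_(y' <- Y) (f x y == f x' y'))%N.
Proof.
move=> fG; pose s := [seq (x, y) | x <- (X : seq T), y <- (Y : seq T')].
have -> : (#|` X| * #|` Y| = size s)%N by rewrite size_allpairs.
have := @collision_seq _ _ s (fun p => f p.1 p.2) G.
rewrite big_allpairs /=.
under eq_bigr do under eq_bigr do rewrite big_allpairs /=.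
by apply => _ /allpairsP[[x y] /= [xX yY ->]]; apply: fG.
Qed.

Definition harmonic_sum (R : numFieldType) (n : nat) : R :=
  \sum_(1 <= i < n.+1) i%:R^-1.

(** Replaces a dyadic pigeonholing: the sum of w is the sum over t of the number
    of s with w s >= t, and comparing this with the harmonic series shows that
    one level t carries its share. *)
Lemma layer_cake (R : realFieldType) (T : choiceType) (S : {fset T})
    (w : T -> nat) (n : nat) :
  (0 < n)%N -> (forall s, s \in S -> (w s <= n)%N) ->
  exists t, [/\ (0 < t)%N, (t <= n)%N
    & (\sum_(s <- S) w s)%:R <=
      harmonic_sum R n * (t%:R * #|` [fset s in S | (t <= w s)%N]|%:R)].
Proof.
move=> n0 wn; set W := (\sum_(s <- S) w s)%N.
have WE : W = (\sum_(1 <= t < n.+1) #|` [fset s in S | (t <= w s)%N]|)%N.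
  under eq_bigr do rewrite card_sep_sum.
  rewrite exchange_big /W big_seq [RHS]big_seq /=; apply: eq_bigr => s sS.
  rewrite (big_cat_nat _ (n := (w s).+1))//=; last by rewrite ltnS wn.
  rewrite [X in (X + _)%N](eq_big_nat _ _ (F2 := fun=> 1%N)); last first.
    by move=> i /andP[_ il]; rewrite -ltnS il.
  rewrite [X in (_ + X)%N](eq_big_nat _ _ (F2 := fun=> 0%N)); last first.
    by move=> i /andP[il _]; rewrite leqNgt il.
  by rewrite sum_nat_const_nat subn1 muln1 big1 ?addn0.
apply: contrapT => /forallNP no.
have {}no t : (1 <= t < n.+1)%N ->
    harmonic_sum R n * #|` [fset s in S | (t <= w s)%N]|%:R < W%:R * t%:R^-1.
  move=> /andP[t0 tn]; rewrite ltr_pdivlMr ?ltr0n//.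
  rewrite ltNge; apply/negP => h; apply: (no t); split => //.
  by apply: le_trans h _; rewrite -mulrA [X in _ * X <= _]mulrC.
have : harmonic_sum R n * W%:R < W%:R * harmonic_sum R n.
  rewrite [in X in X < _]WE natr_sum !mulr_sumr.
  apply: ltr_sum_nat => //.
by rewrite mulrC ltxx.
Qed.
End Counting.

(** * Ruzsa triangle inequalities *)

Section SumsetInequalities.
Local Open Scope fset_scope.
Local Open Scope ring_scope.
Variable V : zmodType.
Implicit Types (X Y Z W U : {fset V}).

Lemma in_fopp X x : (x \in fopp X) = (- x \in X).
Proof.
apply/imfsetP/idP => [[y /= yX ->]|xX]; first by rewrite opprK.
by exists (- x); rewrite ?opprK.
Qed.

Lemma ruzsa_diff U Y W :
  (#|` U +f fopp Y| * #|` W| <= #|` U +f W| * #|` Y +f W|)%N.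
Proof.
have /choice[g gP] : forall z, exists p : V * V,
    z \in U +f fopp Y -> [/\ p.1 \in U, p.2 \in Y & z = p.1 - p.2].
  move=> z; have [|_] := boolP (z \in _); last by exists (0, 0).
  move=> /fsumP[x [y [xU]]]; rewrite in_fopp => yY ->.
  by exists (x, - y); rewrite opprK.
rewrite -!cardfsM.
apply: (@card_le_inj _ _ _ _ (fun p => ((g p.1).1 + p.2, (g p.1).2 + p.2))).
  move=> [z w]; rewrite inE /= => /andP[/gP[gU gY _] wW].
  by rewrite inE /= !in_fsum.
move=> [z w] [z' w']; rewrite !inE /= => /andP[/gP[_ _ zE] _] /andP[/gP[_ _ zE'] _].
move=> [e1 e2].
have zz' : z = z'.
  rewrite zE zE'; have -> : (g z).1 - (g z).2 = ((g z).1 + w) - ((g z).2 + w).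
    by rewrite opprD addrACA subrr addr0.
  by rewrite e1 e2 opprD addrACA subrr addr0.
by move: e1; rewrite -zz' => /addrI->.
Qed.

(** Unlike [ruzsa_diff], the inequality for sums has no elementary injective
    proof; it follows from the Petridis inequality applied to W and Y. *)
Lemma ruzsa_sum U Y W : W != fset0 ->
  (#|` U +f Y| * #|` W| <= #|` U +f W| * #|` Y +f W|)%N.
Proof.
move=> W0; have cW : 0 < #|` W|%:R :> rat by rewrite ltr0n cardfs_gt0.
pose k : rat := #|` Y +f W|%:R / #|` W|%:R.
have [|X [XW X0 kX]] := @petridis_one _ _ W Y k W0.
  by rewrite divfK ?gt_eqF// fsumC.
have le1 : (#|` U +f Y| <= #|` X +f U +f Y|)%N.
  by rewrite -fsumA (fsumC X) card_fsum_ge.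
have le2 : #|` X +f U|%:R <= #|` U +f W|%:R :> rat.
  by rewrite ler_nat fsubset_leq_card// fsumC fsumS// fsubset_refl.
rewrite -(ler_nat rat) !natrM -ler_pdivlMr// -mulrA mulrC.
apply: le_trans (_ : k * #|` X +f U|%:R <= _).
  by apply: le_trans (kX U); rewrite ler_nat.
by rewrite ler_wpM2l// divr_ge0.
Qed.

(** When all summands share the bound k, one applies the Petridis inequality to
    their union; this is where the factor 4 comes from. *)
Lemma plunnecke_four (R : realFieldType) X Y1 Y2 Y3 Y4 (k : R) :
  X != fset0 ->
  #|` X +f Y1|%:R <= k * #|` X|%:R -> #|` X +f Y2|%:R <= k * #|` X|%:R ->
  #|` X +f Y3|%:R <= k * #|` X|%:R -> #|` X +f Y4|%:R <= k * #|` X|%:R ->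
  exists X', [/\ X' `<=` X, X' != fset0
    & #|` X' +f (Y1 +f Y2 +f Y3 +f Y4)|%:R <= (4 * k) ^+ 4 * #|` X'|%:R].
Proof.
move=> X0 h1 h2 h3 h4.
have k_ge0 : 0 <= k.
  rewrite -(@pmulr_lge0 _ #|` X|%:R) ?ltr0n ?cardfs_gt0//.
  exact: le_trans h1.
pose Y := Y1 `|` Y2 `|` Y3 `|` Y4.
have XY : #|` X +f Y|%:R <= 4 * k * #|` X|%:R.
  have : (#|` X +f Y| <= #|` X +f Y1| + #|` X +f Y2| + #|` X +f Y3| + #|` X +f Y4|)%N.
    rewrite ![X +f _]fsumC !fsumUl.
    have leU (S T : {fset V}) : (#|` S `|` T| <= #|` S| + #|` T|)%N.
      by rewrite -[leqRHS]cardfsUI leq_addr.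
    by do 3 (apply: leq_trans (leU _ _) _; rewrite leq_add2r).
  rewrite -(ler_nat R) !natrD; lra.
have [X' [X'X X'0 kX']] := petridis_one X0 XY.
exists X'; split => //.
have sub : X' +f (Y1 +f Y2 +f Y3 +f Y4) `<=` X' +f Y +f Y +f Y +f Y.
  have [s1 s2 s3 s4] : [/\ Y1 `<=` Y, Y2 `<=` Y, Y3 `<=` Y & Y4 `<=` Y].
    by split; apply/fsubsetP => z zY; rewrite !inE zY ?orbT.
  by rewrite !fsumA; do 4 (apply: fsumS => //); apply: fsubset_refl.
apply: le_trans (_ : #|` X' +f Y +f Y +f Y +f Y|%:R <= _).
  by rewrite ler_nat fsubset_leq_card.
have k4 : 0 <= 4 * k by rewrite mulr_ge0.
have step C (a : R) : #|` X' +f C|%:R <= a -> #|` X' +f (C +f Y)|%:R <= 4 * k * a.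
  move=> h; rewrite fsumA; apply: le_trans (kX' C) _.
  exact: ler_wpM2l.
have := step [fset 0] #|` X'|%:R; rewrite fsumX0 => /(_ (lexx _)).
do 3 move/step; rewrite !fsumA fsumX0 => h; apply: le_trans h _.
by rewrite le_eqVlt; apply/orP; left; apply/eqP; ring.
Qed.

End SumsetInequalities.

(** * Harmonic sums *)

Lemma harmonic_sum_ge1 (R : numFieldType) (n : nat) : (0 < n)%N -> 1 <= harmonic_sum R n.
Proof.
move=> n0; rewrite /harmonic_sum big_nat_recl// invr1 lerDl.
by apply: sumr_ge0 => i _; rewrite invr_ge0.
Qed.

Lemma harmonic_sum_le_ln (R : realType) (n : nat) :
  (0 < n)%N -> harmonic_sum R n <= 1 + ln n%:R.
Proof.
case: n => // n _; elim: n => [|n IHn].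
  by rewrite /harmonic_sum big_nat1 invr1 ln1 addr0.
rewrite /harmonic_sum big_nat_recr//=; apply: le_trans (lerD IHn (lexx _)) _.
have n1 : 0 < n.+1%:R :> R by rewrite ltr0n.
have n2 : 0 < n.+2%:R :> R by rewrite ltr0n.
have : ln (1 + - n.+2%:R^-1) <= - n.+2%:R^-1 :> R.
  by apply: le_ln1Dx; rewrite ltrN2 invf_lt1// ltr1n.
have -> : 1 + - n.+2%:R^-1 = n.+1%:R / n.+2%:R :> R.
  apply: (mulIf (lt0r_neq0 n2)).
  by rewrite mulrDl mulNr mulVf ?divfK ?lt0r_neq0// mul1r -[X in X - 1]natr1 addrK.
rewrite ln_div ?posrE//.
by rewrite lerBlDr -lerBlDl opprK addrC -addrA lerD2l addrC.
Qed.

Lemma harmonic_sum_le_powR (R : realType) (n : nat) (e : R) :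
  (0 < n)%N -> 0 < e -> harmonic_sum R n <= (1 + e^-1) * n%:R `^ e.
Proof.
move=> n0 e0; apply: le_trans (harmonic_sum_le_ln R n0) _.
have nR : 0 < n%:R :> R by rewrite ltr0n.
have ln0 : 0 <= ln n%:R :> R by rewrite ln_ge0// ler1n.
have h : 1 + e * ln n%:R <= n%:R `^ e.
  by rewrite /powR gt_eqF// expR_ge1Dx.
have h1 : 1 <= n%:R `^ e by apply: le_trans h; rewrite lerDl mulr_ge0// ltW.
have h2 : ln n%:R <= e^-1 * n%:R `^ e.
  rewrite -(ler_pM2l e0) mulrA divff ?gt_eqF// mul1r; lra.
by rewrite mulrDl mul1r; apply: lerD.
Qed.

(** * Sets almost closed under halving *)

(** The maps b |-> b / 2 and b |-> (b + 1) / 2 are contractions whose images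
    cover [0, 1].  Suppose that all points of [0, 1] are within r of B.  A point t
    is the image of some u under one of these maps; u is within r of some b in B,
    so t is within r / 2 of the image of b, which is within eps of B.  The
    distance thus improves from r to r / 2 + eps, and tends to 2 eps. *)
Lemma dense_of_halving (R : archiRealFieldType) (B : R -> Prop) (eps : R) :
  0 < eps -> B 0 -> B 1 ->
  (forall b, B b -> 0 <= b <= 1 -> exists2 b', B b' & `|b' - b / 2| <= eps) ->
  (forall b, B b -> 0 <= b <= 1 -> exists2 b', B b' & `|b' - (b + 1) / 2| <= eps) ->
  forall t, 0 <= t <= 1 -> exists b, [/\ B b, 0 <= b <= 1 & `|t - b| <= 3 * eps].
Proof.
move=> eps0 B0 B1 Bl Br.
(* The approximating element may fall slightly outside of [0, 1]; then 0 or 1 is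
   closer. *)
have clip c b' : B b' -> 0 <= c <= 1 -> `|b' - c| <= eps ->
    exists b, [/\ B b, 0 <= b <= 1 & `|b - c| <= eps].
  move=> Bb' c01; rewrite ler_norml => hb'.
  have [b'0|b'0] := ltP b' 0.
    by exists 0; split => //; rewrite ?ler_norml; lra.
  have [b'1|b'1] := ltP 1 b'.
    by exists 1; split => //; rewrite ?ler_norml; lra.
  by exists b'; split; rewrite ?ler_norml ?b'0.
have near n : forall t, 0 <= t <= 1 ->
    exists b, [/\ B b, 0 <= b <= 1 & `|t - b| <= 2^-1 ^+ n + 2 * eps].
  elim: n => [|n IHn] t t01.
    exists 0; split => //; rewrite ?ler_norml ?expr0; lra.
  have [t2|t2] := leP t 2^-1.
    have [|b [Bb b01]] := IHn (2 * t); first lra.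
    rewrite ler_norml => tb.
    have [b' Bb'] := Bl b Bb b01; move=> /(clip (b / 2) b' Bb')[|b2 [Bb2 b201]].
      lra.
    rewrite ler_norml => hb2; exists b2; split => //; rewrite exprS ler_norml; lra.
  have [|b [Bb b01]] := IHn (2 * t - 1); first lra.
  rewrite ler_norml => tb.
  have [b' Bb'] := Br b Bb b01; move=> /(clip ((b + 1) / 2) b' Bb')[|b2 [Bb2 b201]].
    lra.
  rewrite ler_norml => hb2; exists b2; split => //; rewrite exprS ler_norml; lra.
move=> t t01.
have [n hn] : exists n, 2^-1 ^+ n <= eps.
  exists (Num.bound eps^-1).
  have e1 : 0 <= eps^-1 by rewrite invr_ge0 ltW.
  have := archi_boundP e1 => lt.
  rewrite exprVn invf_ple ?posrE ?exprn_gt0//.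
  apply: le_trans (ltW lt) _; rewrite -natrX ler_nat.
  exact: ltnW (ltn_expl _ _).
have [b [Bb b01 tb]] := near n t t01; exists b; split => //; lra.
Qed.

(** * Discretisation at scale delta *)

Lemma floor_bounds (R : archiRealDomainType) (x : R) :
  (Num.floor x)%:~R <= x /\ x < (Num.floor x)%:~R + 1.
Proof. by have /andP[h1] := floor_itv x; rewrite intrD. Qed.

Lemma int_between (R : numDomainType) (e : int) (m : nat) :
  - 1 < e%:~R :> R -> e%:~R < m%:R :> R -> 0 <= e < m%:Z.
Proof.
rewrite -[m%:R]/((Posz m)%:~R) ltr_int => h ->; rewrite andbT.
by move: h; rewrite -[-1]/((-1)%:~R) ltr_int; lia.
Qed.

Section Discretisation.
Local Open Scope fset_scope.
Local Open Scope ring_scope.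
Variables (R : realType) (delta : R) (A : {fset R}).
Hypothesis delta0 : 0 < delta.
Hypothesis A12 : forall x, x \in A -> 1 <= x <= 2.
Hypothesis Asep : forall x y, x \in A -> y \in A -> x != y -> delta <= `|x - y|.

Definition dilate_floor (a : R) : {fset int} :=
  [fset Num.floor (a * x / delta) | x in A].

Definition sum_floor : {fset int} :=
  [fset Num.floor ((x + y) / delta) | x in A, y in A].

Definition prod_floor : {fset int} :=
  [fset Num.floor (x * y / delta) | x in A, y in A].

Lemma in_dilate_floor a x : x \in A -> Num.floor (a * x / delta) \in dilate_floor a.
Proof. by move=> xA; apply/imfsetP; exists x. Qed.

Lemma floor_eq_dist (u v : R) :
  Num.floor (u / delta) = Num.floor (v / delta) -> `|u - v| < delta.
Proof.
move=> e; have [h1 h2] := floor_bounds (u / delta).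
have [h3 h4] := floor_bounds (v / delta); rewrite e in h1 h2.
have : `|u / delta - v / delta| < 1 by rewrite ltr_norml; apply/andP; split; lra.
by rewrite -mulrBl normrM normfV (gtr0_norm delta0) ltr_pdivrMr ?mul1r.
Qed.

Lemma dilate_floor_inj a x y : 1 <= a -> x \in A -> y \in A ->
  Num.floor (a * x / delta) = Num.floor (a * y / delta) -> x = y.
Proof.
move=> a1 xA yA /floor_eq_dist; rewrite -mulrBr normrM => h.
apply/eqP; apply: contraTT isT => /(Asep xA yA) h'.
have : delta < delta.
  apply: le_lt_trans h; apply: le_trans h' _.
  by rewrite ler_peMl// ger0_norm// (le_trans ler01).
by rewrite ltxx.
Qed.

Lemma card_dilate_floor a : 1 <= a -> #|` dilate_floor a| = #|` A|.
Proof. by move=> a1; rewrite card_in_imfset// => x y xA yA; apply: dilate_floor_inj. Qed.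

Lemma card_fsum_dilate_floor a : 1 <= a <= 2 ->
  (#|` dilate_floor a +f dilate_floor a| <= 4 * #|` sum_floor|)%N.
Proof.
move=> a12.
apply: (@card_le_cover _ _ _ (fun q => Num.floor (a * q%:~R) - 1)) => p.
move=> /fsumP[_ [_ [/imfsetP[x /= xA ->] /imfsetP[y /= yA ->] ->]]].
exists (Num.floor ((x + y) / delta)).
  by apply/imfset2P; exists x => //; exists y.
have [h1 h2] := floor_bounds (a * x / delta).
have [h3 h4] := floor_bounds (a * y / delta).
have [h5 h6] := floor_bounds ((x + y) / delta).
move: h1 h2 h3 h4 h5 h6.
set k := Num.floor (_ / delta); set l := Num.floor (_ / delta).
set m := Num.floor (_ / delta) => h1 h2 h3 h4 h5 h6.
have [h7 h8] := floor_bounds (a * m%:~R).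
have h9 : a * m%:~R <= a * ((x + y) / delta) by rewrite ler_wpM2l//; lra.
have h10 : a * ((x + y) / delta) < a * m%:~R + 2.
  by apply: lt_le_trans (_ : a * (m%:~R + 1) <= _); [rewrite ltr_pM2l//; lra|lra].
by apply: (@int_between R); rewrite !intrD !rmorphN /=; lra.
Qed.

(** The number of coincidences between the two dilates is the size of their
    intersection because rounding is injective on dilates of a separated set. *)
Lemma card_setI_dilate_floor a b : 1 <= a -> 1 <= b ->
  (\sum_(x <- A) \sum_(y <- A)
      (Num.floor (a * x / delta) == Num.floor (b * y / delta))
    <= #|` dilate_floor a `&` dilate_floor b|)%N.
Proof.
move=> a1 b1.
have -> : (\sum_(x <- A) \sum_(y <- A)
      (Num.floor (a * x / delta) == Num.floor (b * y / delta)))%N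
    = (\sum_(x <- A) (Num.floor (a * x / delta) \in dilate_floor b))%N.
  rewrite big_seq [RHS]big_seq; apply: eq_bigr => x xA.
  have [/imfsetP[y /= yA e]|no] := boolP (_ \in _).
    rewrite (big_fsetD1 y)//= e eqxx big1_seq// => z /andP[_].
    rewrite !inE => /andP[zy zA]; apply/eqP; rewrite eqb0.
    by apply: contra zy => /eqP/(dilate_floor_inj b1 yA zA)->.
  rewrite big1_seq// => y /andP[_ yA]; apply/eqP; rewrite eqb0.
  by apply: contra no => /eqP->; apply: in_dilate_floor.
rewrite -card_sep_sum.
apply: (@card_le_inj _ _ _ _ (fun x => Num.floor (a * x / delta))) => [x|x y].
  by rewrite !inE /= => /andP[xA ->]; rewrite in_dilate_floor.
by rewrite !inE /= => /andP[xA _] /andP[yA _]; apply: dilate_floor_inj.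
Qed.

(** The collisions of (a, x) |-> a x are counted by the sum over a and b of
    #(P_a :&: P_b); a popular b and a popular level t are then selected.  The
    product of t and the number of selected a is what later arguments need, and
    the level t itself is left free. *)
Lemma popular_dilate : A != fset0 ->
  exists b t, [/\ b \in A, (0 < t <= #|` A|)%N
    & #|` A|%:R ^+ 3 <= #|` prod_floor|%:R * harmonic_sum R #|` A| *
      (t%:R * #|` [fset a in A | (t <= #|` dilate_floor a `&` dilate_floor b|)%N]|%:R)].
Proof.
move=> A0; have cA : (0 < #|` A|)%N by rewrite cardfs_gt0.
pose w a b := #|` dilate_floor a `&` dilate_floor b|.
have [b bA hb] : exists2 b, b \in A &
    (#|` A| ^ 3 <= #|` prod_floor| * \sum_(a <- A) w a b)%N.
  apply: contrapT => no.
  have {}no b : b \in A -> (#|` prod_floor| * \sum_(a <- A) w a b < #|` A| ^ 3)%N.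
    by move=> bA; rewrite ltnNge; apply/negP => h; apply: no; exists b.
  have fG a x : a \in A -> x \in A -> Num.floor (a * x / delta) \in prod_floor.
    by move=> aA xA; apply/imfset2P; exists a => //; exists x.
  have := collision fG; apply/negP; rewrite -ltnNge.
  have : (#|` prod_floor| * \sum_(b <- A) \sum_(a <- A) w a b < (#|` A| * #|` A|) ^ 2)%N.
    have -> : ((#|` A| * #|` A|) ^ 2 = \sum_(b <- A) #|` A| ^ 3)%N.
      by rewrite big_const_seq count_predT iter_addn_0; ring.
    have : (\sum_(b <- A) (1 + #|` prod_floor| * \sum_(a <- A) w a b)
        <= \sum_(b <- A) #|` A| ^ 3)%N.
      by rewrite big_seq [leqRHS]big_seq; apply: leq_sum => b /no.
    rewrite big_split /= -big_distrr /= => /(leq_trans _); apply.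
    by rewrite -card_fset_sum1 -[X in (X < _)%N]add0n ltn_add2r.
  apply: leq_ltn_trans; rewrite leq_mul2l; apply/orP; right.
  rewrite [leqRHS]exchange_big big_seq [leqRHS]big_seq /=; apply: leq_sum => a aA.
  rewrite exchange_big big_seq [leqRHS]big_seq /=; apply: leq_sum => b bA.
  by apply: card_setI_dilate_floor; [have /andP[] := A12 aA|have /andP[] := A12 bA].
have [|t [t0 tA hw]] := @layer_cake R _ A (w^~ b) #|` A| cA.
  move=> a aA; have /andP[a1 _] := A12 aA.
  by rewrite -(card_dilate_floor a1) fsubset_leq_card// fsubsetIl.
exists b, t; split => //; first by rewrite t0.
rewrite -mulrA; apply: le_trans (_ : #|` prod_floor|%:R * (\sum_(a <- A) w a b)%:R <= _).
  by rewrite -natrM -natrX ler_nat.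
exact: ler_wpM2l.
Qed.

(** The intersection of the dilates serves as the middle set of the triangle
    inequalities: its sum with either dilate is contained in a dilate of the sum
    set. *)
Lemma card_dilate_sums a b (t : nat) : a \in A -> b \in A ->
  (t <= #|` dilate_floor a `&` dilate_floor b|)%N -> (0 < t)%N ->
  (#|` dilate_floor b +f dilate_floor a| * t <= 16 * #|` sum_floor| ^ 2)%N /\
  (#|` dilate_floor b +f fopp (dilate_floor a)| * t <= 16 * #|` sum_floor| ^ 2)%N.
Proof.
move=> aA bA tw t0; set W := _ `&` _ in tw.
have W0 : W != fset0 by rewrite -cardfs_gt0 (leq_trans t0).
have le x : x \in A -> W `<=` dilate_floor x ->
    (#|` dilate_floor x +f W| <= 4 * #|` sum_floor|)%N.
  move=> xA Wx; apply: leq_trans (card_fsum_dilate_floor (A12 xA)).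
  by apply: fsubset_leq_card; apply: fsumS => //; apply: fsubset_refl.
have h : (#|` dilate_floor b +f W| * #|` dilate_floor a +f W|
    <= 16 * #|` sum_floor| ^ 2)%N.
  have -> : (16 * #|` sum_floor| ^ 2 = (4 * #|` sum_floor|) * (4 * #|` sum_floor|))%N by ring.
  by apply: leq_mul; apply: le => //; [apply: fsubsetIr|apply: fsubsetIl].
split; apply: leq_trans h.
  apply: leq_trans (ruzsa_sum _ _ W0); exact: leq_mul.
apply: leq_trans (ruzsa_diff _ _ W); exact: leq_mul.
Qed.

End Discretisation.

(** * Frostman sets and sums of dilates *)

Lemma sum_le_card (R : numDomainType) (T : choiceType) (X : {fset T})
    (F : T -> R) (k : R) :
  (forall x, x \in X -> F x <= k) -> \sum_(x <- X) F x <= k * #|` X|%:R.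
Proof.
move=> Fk; have -> : k * #|` X|%:R = \sum_(x <- X) k.
  by rewrite big_const_seq count_predT iter_addr_0 mulr_natr.
by rewrite big_seq [leRHS]big_seq; apply: ler_sum => x xX; apply: Fk.
Qed.

Section Frostman.
Local Open Scope fset_scope.
Local Open Scope ring_scope.
Variables (R : realType) (delta sigma C : R) (A : {fset R}).
Hypothesis delta01 : 0 < delta < 1.
Hypothesis sigma01 : 0 < sigma < 1.
Hypothesis C0 : 0 < C.
Hypothesis A12 : forall x, x \in A -> 1 <= x <= 2.
Hypothesis Asep : forall x y, x \in A -> y \in A -> x != y -> delta <= `|x - y|.

Definition frostman := forall u l, delta <= l ->
  #|` [fset x in A | u <= x <= u + l]|%:R <= C * l `^ sigma * #|` A|%:R.

Hypothesis Afrost : frostman.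

Let delta0 : 0 < delta. Proof. by case/andP: delta01. Qed.

Lemma powR_mul_le (c l : R) : 1 <= c -> 0 <= l -> (c * l) `^ sigma <= c * l `^ sigma.
Proof.
move=> c1 l0; have c0 : 0 <= c := le_trans ler01 c1; rewrite powRM//.
by rewrite ler_wpM2r ?powR_ge0// ler1_powR//; case/andP: sigma01 => _ /ltW.
Qed.

Lemma frostman_scaled (c l u : R) : 1 <= c -> delta <= l ->
  #|` [fset x in A | u <= x <= u + c * l]|%:R <= c * C * l `^ sigma * #|` A|%:R.
Proof.
move=> c1 dl; have l0 : 0 < l := lt_le_trans delta0 dl.
apply: le_trans (Afrost _ _) _.
  by apply: le_trans dl _; rewrite ler_peMl// ltW.
rewrite ler_wpM2r//; have := powR_mul_le c1 (ltW l0).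
by move/(ler_wpM2l (ltW C0)); lra.
Qed.

Lemma frostman_ball (rho x : R) : delta <= rho ->
  #|` [fset y in A | `|x - y| < rho]|%:R <= 2 * C * rho `^ sigma * #|` A|%:R.
Proof.
move=> dr; apply: le_trans (@frostman_scaled 2 rho (x - rho) _ dr); last by rewrite ler1n.
rewrite ler_nat; apply: fsubset_leq_card; apply/fsubsetP => y; rewrite !inE /=.
by rewrite ltr_norml => /andP[->] /= h; lra.
Qed.

Definition combo_floor (d1 d : R) : {fset int} :=
  [fset Num.floor ((d1 * x + d * y) / delta) | x in A, y in A].

Local Notation dilate_floor := (dilate_floor delta A).

(** The set of combinations lies in an interval of length about 3 d / delta, so
    the admissible p come from points of A in an interval of length 5 d. *)
Lemma card_fset_between (b : R) (s : int) (d1 d : R) : b \in A ->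
  0 <= d1 <= d -> delta <= d ->
  #|` [fset p in dilate_floor b | s - p \in combo_floor d1 d]|%:R
    <= 5 * C * d `^ sigma * #|` A|%:R.
Proof.
move=> bA d1d deltad; have /andP[b1 b2] := A12 bA.
have b0 : 0 < b := lt_le_trans ltr01 b1.
have D1 : 1 <= d / delta by rewrite ler_pdivlMr// mul1r.
set D := d / delta in D1 *.
have DE : D * delta = d by rewrite divfK ?gt_eqF.
pose u := (s%:~R - 4 * D) * (delta / b).
have eta0 : 0 < delta / b by rewrite divr_gt0.
have ee : D * (delta / b) <= d.
  by rewrite mulrA DE ler_pdivrMr// ler_peMr// -DE mulr_ge0// ltW// (lt_le_trans ltr01).
apply: le_trans (@frostman_scaled 5 d u _ deltad); last by rewrite ler1n.
rewrite ler_nat.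
pose S := [fset x in A | u <= x <= u + 5 * d].
have imS : (#|` [fset Num.floor (b * x / delta) | x in S]| <= #|` S|)%N.
  exact: leq_imfset_card.
apply: leq_trans imS.
apply: fsubset_leq_card; apply/fsubsetP => p; rewrite !inE /= => /andP[].
move=> /imfsetP[x /= xA ->] /imfset2P[y /= yA [z /= zA e]].
apply/imfsetP; exists x => //=; rewrite !inE xA /=.
have [h1 h2] := floor_bounds (b * x / delta).
have [h3 h4] := floor_bounds ((d1 * y + d * z) / delta).
move: h3 h4; rewrite -e intrB => h3 h4.
have /andP[y1 y2] := A12 yA; have /andP[z1 z2] := A12 zA.
have /andP[d10 d1d'] := d1d.
have d0 : 0 <= d by lra.
have g1 : D <= (d1 * y + d * z) / delta.
  rewrite ler_pM2r ?invr_gt0//.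
  have : 0 <= d1 * y by rewrite mulr_ge0//; lra.
  have : d * 1 <= d * z by rewrite ler_wpM2l.
  lra.
have g2 : (d1 * y + d * z) / delta <= 4 * D.
  rewrite mulrA ler_pM2r ?invr_gt0//.
  have : d1 * y <= d * 2 by apply: ler_pM => //; lra.
  have : d * z <= d * 2 by rewrite ler_wpM2l.
  lra.
have xE : x = (b * x / delta) * (delta / b).
  by field; rewrite !gt_eqF.
set v := b * x / delta in h1 h2 xE.
rewrite {1 2}xE; apply/andP; split.
  rewrite ler_wpM2r ?(ltW eta0)//; lra.
apply: le_trans (_ : (s%:~R - D + 2) * (delta / b) <= _).
  rewrite ler_wpM2r ?(ltW eta0)//; lra.
have : 1 * (delta / b) <= D * (delta / b) by rewrite ler_wpM2r ?(ltW eta0).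
rewrite /u; lra.
Qed.

(** Localised Plunnecke inequality.  With G the set of combinations and X the
    subset of P_b provided by [plunnecke_four], #(X + G) <= 4 (4 k)^4 #X.  An
    element of X + G has at most m representations, m being the maximal number
    of points of P_b in an interval of the length of G, whence #G #X <= m #(X + G). *)
Lemma card_combo_floor (b a1 a2 a3 a4 k : R) :
  b \in A -> a1 \in A -> a2 \in A -> a3 \in A -> a4 \in A ->
  #|` dilate_floor b +f dilate_floor a1|%:R <= k * #|` A|%:R ->
  #|` dilate_floor b +f fopp (dilate_floor a2)|%:R <= k * #|` A|%:R ->
  #|` dilate_floor b +f dilate_floor a3|%:R <= k * #|` A|%:R ->
  #|` dilate_floor b +f fopp (dilate_floor a4)|%:R <= k * #|` A|%:R ->
  0 <= a1 - a2 <= a3 - a4 -> delta <= a3 - a4 ->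
  #|` combo_floor (a1 - a2) (a3 - a4)|%:R
    <= 5 * 2 ^+ 10 * k ^+ 4 * C * (a3 - a4) `^ sigma * #|` A|%:R.
Proof.
move=> bA a1A a2A a3A a4A h1 h2 h3 h4 d1d deltad.
have /andP[b1 b2] := A12 bA.
have cPb := card_dilate_floor delta0 Asep b1.
have Pb0 : dilate_floor b != fset0.
  by rewrite -cardfs_gt0 cPb cardfs_gt0; apply/fset0Pn; exists b.
rewrite -cPb in h1 h2 h3 h4.
have [X [XP X0 cX]] := plunnecke_four Pb0 h1 h2 h3 h4.
set T := dilate_floor a1 +f _ +f _ +f _ in cX; set d1 := a1 - a2 in d1d *; set d := a3 - a4 in d1d deltad *.
pose G := combo_floor d1 d.
have XG : (#|` X +f G| <= 4 * #|` X +f T|)%N.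
  apply: (@card_le_cover _ _ _ (fun q => q - 2)) => s /fsumP[p [g [pX + ->]]].
  move=> /imfset2P[x /= xA [y /= yA ->]].
  exists (p + (Num.floor (a1 * x / delta) - Num.floor (a2 * x / delta)
    + Num.floor (a3 * y / delta) - Num.floor (a4 * y / delta))).
    apply: in_fsum => //; do !apply: in_fsum; rewrite ?in_fopp ?opprK;
    exact: in_dilate_floor.
  have [e1 e2] := floor_bounds (a1 * x / delta).
  have [e3 e4] := floor_bounds (a2 * x / delta).
  have [e5 e6] := floor_bounds (a3 * y / delta).
  have [e7 e8] := floor_bounds (a4 * y / delta).
  have [e9 e10] := floor_bounds ((d1 * x + d * y) / delta).
  have E : (d1 * x + d * y) / delta = a1 * x / delta - a2 * x / delta
    + a3 * y / delta - a4 * y / delta by rewrite /d1 /d; ring.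
  rewrite E in e9 e10 *.
  by apply: (@int_between R); rewrite !(intrD, rmorphN) /=; lra.
have count : #|` G|%:R * #|` X|%:R
    <= 5 * C * d `^ sigma * #|` A|%:R * #|` X +f G|%:R.
  apply: (@double_count _ _ _ X (X +f G) (fun p s => s - p \in G)) => [p pX|s _].
    rewrite ler_nat; apply: (@card_le_inj _ _ _ _ (fun g => p + g)) => [g gG|g g' _ _ /addrI//].
    by rewrite !inE /= in_fsum// addrC addrA addNr add0r.
  have le := card_fset_between s bA d1d deltad; apply: le_trans le.
  rewrite ler_nat; apply: fsubset_leq_card; apply/fsubsetP => p.
  by rewrite !inE /= => /andP[/(fsubsetP XP)-> ->].
have cX0 : 0 < #|` X|%:R :> R by rewrite ltr0n cardfs_gt0.
rewrite -(ler_pM2r cX0); apply: le_trans count _.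
have q0 : 0 <= 5 * C * d `^ sigma * #|` A|%:R.
  by rewrite !mulr_ge0 ?powR_ge0// ltW.
have : #|` X +f G|%:R <= 4 * ((4 * k) ^+ 4 * #|` X|%:R).
  apply: le_trans (_ : 4 * #|` X +f T|%:R <= _); first by rewrite -natrM ler_nat.
  by rewrite ler_wpM2l.
move/(ler_wpM2l q0) => h; apply: le_trans h _.
by rewrite le_eqVlt; apply/orP; left; apply/eqP; ring.
Qed.
End Frostman.

(** * Well-spaced quotients *)

Section Dense.
Local Open Scope fset_scope.
Local Open Scope ring_scope.
Variables (R : realType) (delta sigma C : R) (A : {fset R}).
Hypothesis delta01 : 0 < delta < 1.
Hypothesis sigma01 : 0 < sigma < 1.
Hypothesis C0 : 0 < C.
Hypothesis Afrost : frostman delta sigma C A.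
Hypothesis Acard : #|` A|%:R = delta `^ (- sigma).

Let delta0 : 0 < delta. Proof. by case/andP: delta01. Qed.

Lemma card_near_sum (rho x : R) : delta <= rho ->
  \sum_(x' <- A) (`|x - x'| < rho)%R%:R <= 2 * C * rho `^ sigma * #|` A|%:R :> R.
Proof.
move=> dr; have := frostman_ball delta01 sigma01 C0 Afrost x dr.
by rewrite card_sep_sum natr_sum.
Qed.

(** The collisions for the quotient d1 j / d j are weighted by (d j)^sigma, to
    match the upper bound on the number of combinations.  Those with
    rho-separated first coordinates determine j, because the quotients are
    spaced by more than the tolerance; their total weight is at most N^4.  The
    others are counted for each j separately, by the Frostman condition at the
    scales rho and delta / d j: the weight cancels the dependence on d j. *)
Lemma separated_quotients_bound (J : nat) (d1 d : 'I_J -> R) (rho H : R) :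
  delta <= rho -> 0 <= H ->
  (forall j, rho <= d j <= 1) -> (forall j, 0 <= d1 j <= d j) ->
  (forall i j, i != j -> 2 * delta / rho ^+ 2 <= `|d1 i / d i - d1 j / d j|) ->
  (forall j, #|` combo_floor delta A (d1 j) (d j)|%:R <= H * d j `^ sigma * #|` A|%:R) ->
  J%:R <= H * (#|` A|%:R + 4 * C ^+ 2 * rho `^ sigma * J%:R).
Proof.
move=> dr H0 dj d1j sep GH.
have rho0 : 0 < rho := lt_le_trans delta0 dr.
have dj0 j : 0 < d j by apply: lt_le_trans rho0 _; case/andP: (dj j).
set N : R := #|` A|%:R.
have N0 : 0 < N by rewrite /N Acard powR_gt0.
pose coll j x y x' y' :=
  Num.floor ((d1 j * x + d j * y) / delta) == Num.floor ((d1 j * x' + d j * y') / delta).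
have collP j x y x' y' : coll j x y x' y' ->
    `|d1 j / d j * (x - x') + (y - y')| < delta / d j.
  move=> /eqP/(floor_eq_dist delta0) h; rewrite ltr_pdivlMr//; apply: le_lt_trans h.
  rewrite -[X in _ * X](gtr0_norm (dj0 j)) -normrM le_eqVlt; apply/orP; left; apply/eqP.
  by congr `|_|; field; rewrite gt_eqF.
pose far j := (\sum_(x <- A) \sum_(y <- A) \sum_(x' <- A) \sum_(y' <- A)
  (coll j x y x' y' && (rho <= `|x - x'|)%R))%N.
pose near j := (\sum_(x <- A) \sum_(y <- A) \sum_(x' <- A) \sum_(y' <- A)
  (coll j x y x' y' && (`|x - x'| < rho)%R))%N.
have hQ j : ((#|` A| * #|` A|) ^ 2 <= #|` combo_floor delta A (d1 j) (d j)| * (far j + near j))%N.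
  have fG x y : x \in A -> y \in A ->
      Num.floor ((d1 j * x + d j * y) / delta) \in combo_floor delta A (d1 j) (d j).
    by move=> xA yA; apply/imfset2P; exists x => //; exists y.
  apply: leq_trans (collision fG) _; rewrite leq_mul2l; apply/orP; right.
  rewrite /far /near -big_split /=; apply: leq_sum => x _.
  rewrite -big_split /=; apply: leq_sum => y _.
  rewrite -big_split /=; apply: leq_sum => x' _.
  rewrite -big_split /=; apply: leq_sum => y' _.
  by rewrite -/(coll j x y x' y') ltNge; case: (coll _ _ _ _ _); case: (rho <= _).
have far_sum : (\sum_j far j)%:R <= N ^+ 4.
  have -> : N ^+ 4 = (\sum_(x <- A) \sum_(y <- A) \sum_(x' <- A) \sum_(y' <- A) 1)%:R.
    rewrite -card_fset_sum1 !big_const_seq !count_predT !iter_addn_0 /N !natrM; ring.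
  rewrite ler_nat /far exchange_big; apply: leq_sum => x _.
  rewrite exchange_big; apply: leq_sum => y _.
  rewrite exchange_big; apply: leq_sum => x' _.
  rewrite exchange_big; apply: leq_sum => y' _.
  have [[j /andP[cj xx]]|no] := pselect (exists j, coll j x y x' y' && (rho <= `|x - x'|)).
    rewrite (bigD1 j)//= big1 ?addn0 ?leq_b1// => i ij.
    apply/eqP; rewrite eqb0; apply/negP => /andP[ci _].
    have := sep i j ij; apply/negP; rewrite -ltNge.
    have dle k : delta / d k <= delta / rho.
      by rewrite ler_wpM2l ?(ltW delta0)// lef_pV2 ?posrE//; case/andP: (dj k).
    have hi := lt_le_trans (collP _ _ _ _ _ ci) (dle i).
    have hj := lt_le_trans (collP _ _ _ _ _ cj) (dle j).
    have : `|d1 i / d i - d1 j / d j| * `|x - x'| < 2 * delta / rho.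
      rewrite -normrM mulrBl.
      move: hi hj; rewrite !ltr_norml => /andP[? ?] /andP[? ?]; lra.
    have e : 2 * delta / rho ^+ 2 * rho = 2 * delta / rho by field; rewrite gt_eqF.
    move=> h; have : (2 * delta / rho ^+ 2) * rho <= (2 * delta / rho ^+ 2) * `|x - x'|.
      by rewrite ler_wpM2l// divr_ge0 ?exprn_ge0// ?mulr_ge0// ltW.
    rewrite e => /(lt_le_trans h); rewrite ltr_pM2r//.
    exact: lt_le_trans xx.
  by rewrite big1// => j _; apply/eqP; rewrite eqb0; apply/negP => h; apply: no; exists j.
have deltaN : delta `^ sigma * N = 1.
  by rewrite /N Acard powRN mulfV// gt_eqF// powR_gt0.
(* There are at most 2 C rho^sigma N choices of x', then at most
   2 C (delta / d j)^sigma N choices of y', and delta^sigma N = 1. *)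
have near_le j : (near j)%:R * d j `^ sigma <= 4 * C ^+ 2 * rho `^ sigma * N ^+ 3.
  have dd : delta <= delta / d j.
    by rewrite ler_peMr ?(ltW delta0)// invf_ge1// ?dj0//; case/andP: (dj j).
  pose q := 2 * C * (delta / d j) `^ sigma * N.
  have inner x y x' :
      (\sum_(y' <- A) (coll j x y x' y' && (`|x - x'| < rho)%R))%:R <= q * (`|x - x'| < rho)%R%:R.
    case: (`|x - x'| < rho); last first.
      by rewrite big1 ?mulr0// => y' _; rewrite andbF.
    rewrite mulr1; under eq_bigr do rewrite andbT.
    rewrite -card_sep_sum.
    have := frostman_scaled delta01 sigma01 C0 Afrost
      (y + d1 j / d j * (x - x') - delta / d j) (ler1n R 2) dd.
    apply: le_trans; rewrite ler_nat; apply: fsubset_leq_card; apply/fsubsetP => y'.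
    rewrite !inE /= => /andP[-> /collP]; rewrite ltr_norml /= => /andP[h1 h2]; lra.
  have q0 : 0 <= q by rewrite !mulr_ge0 ?powR_ge0// ltW.
  have : (near j)%:R <= q * (2 * C * rho `^ sigma * N) * N * N.
    rewrite /near natr_sum; apply: sum_le_card => x xA.
    rewrite natr_sum; apply: sum_le_card => y yA.
    rewrite natr_sum; apply: le_trans (_ : \sum_(x' <- A) q * (`|x - x'| < rho)%R%:R <= _).
      by apply: ler_sum.
    by rewrite -mulr_sumr ler_wpM2l// card_near_sum.
  move/(ler_wpM2r (powR_ge0 (d j) sigma)) => h; apply: le_trans h _.
  rewrite le_eqVlt; apply/orP; left; apply/eqP.
  have qd : q * d j `^ sigma = 2 * C.
    rewrite /q -[RHS]mulr1 -deltaN.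
    have -> : delta `^ sigma = (delta / d j) `^ sigma * d j `^ sigma.
      by rewrite -powRM ?divfK ?gt_eqF// ?divr_ge0// ltW.
    ring.
  transitivity (q * d j `^ sigma * (2 * C * rho `^ sigma * N) * N * N); first by ring.
  by rewrite qd; ring.
have main j : N ^+ 3 <= H * ((far j)%:R + 4 * C ^+ 2 * rho `^ sigma * N ^+ 3).
  have h1 : N ^+ 4 <= H * d j `^ sigma * N * ((far j)%:R + (near j)%:R).
    apply: le_trans (_ : #|` combo_floor delta A (d1 j) (d j)|%:R * ((far j)%:R + (near j)%:R) <= _).
      by have := hQ j; rewrite -(ler_nat R) natrM natrX natrM natrD -/N; apply: le_trans; rewrite exprMn -exprD.
    by apply: ler_wpM2r (GH j); rewrite addr_ge0.
  rewrite -(ler_pM2r N0) -exprSr; apply: le_trans h1 _.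
  have dj1 : d j `^ sigma <= 1.
    apply: le_trans (_ : 1 `^ sigma <= _); last by rewrite powR1.
    apply: ge0_ler_powR; rewrite ?nnegrE ?ler01 ?(ltW (dj0 j))//.
      by case/andP: sigma01 => /ltW.
    by case/andP: (dj j).
  have h2 : (far j)%:R * d j `^ sigma <= (far j)%:R by rewrite ler_piMr.
  have h3 := near_le j.
  have : H * N * (d j `^ sigma * ((far j)%:R + (near j)%:R))
     <= H * N * ((far j)%:R + 4 * C ^+ 2 * rho `^ sigma * N ^+ 3).
    by apply: ler_wpM2l; [rewrite mulr_ge0// ltW|lra].
  lra.
have N3 : 0 < N ^+ 3 by rewrite exprn_gt0.
rewrite -(ler_pM2r N3).
have : \sum_(j < J) N ^+ 3 <= \sum_j (H * ((far j)%:R + 4 * C ^+ 2 * rho `^ sigma * N ^+ 3)).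
  by apply: ler_sum => j _.
rewrite -mulr_sumr big_split /= -natr_sum !sumr_const card_ord -(mulr_natl (N ^+ 3)) -(mulr_natl (_ * N ^+ 3)) => h.
apply: le_trans h _; rewrite -[leRHS]mulrA; apply: ler_wpM2l => //.
have -> : (N + 4 * C ^+ 2 * rho `^ sigma * J%:R) * N ^+ 3
  = N ^+ 4 + J%:R * (4 * C ^+ 2 * rho `^ sigma * N ^+ 3) by ring.
exact: lerD.
Qed.
End Dense.

(** * An isolated quotient *)

Section Sparse.
Local Open Scope fset_scope.
Local Open Scope ring_scope.
Variables (R : realType) (delta sigma C : R) (A A1 : {fset R}).
Hypothesis delta01 : 0 < delta < 1.
Hypothesis sigma01 : 0 < sigma < 1.
Hypothesis C0 : 0 < C.
Hypothesis Asep : forall x y, x \in A -> y \in A -> x != y -> delta <= `|x - y|.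
Hypothesis Afrost : frostman delta sigma C A.
Hypothesis Acard : #|` A|%:R = delta `^ (- sigma).
Hypothesis A1A : A1 `<=` A.
Hypothesis A10 : A1 != fset0.

Let delta0 : 0 < delta. Proof. by case/andP: delta01. Qed.
Let A1A' x : x \in A1 -> x \in A. Proof. exact: (fsubsetP A1A). Qed.

(** Among the cells of length delta / d, keep those that contain at least m
    points of A1, with m provided by [layer_cake].  Since each kept cell contains
    m points that are delta-separated, each sum of two cells contains m elements
    of the sum set at scale delta: the doubling of the set Z of cells at the
    coarse scale is bounded by that of A at scale delta. *)
Lemma uniform_scale (d : R) : delta <= d <= 1 ->
  exists (Z : {fset int}) (A2 : {fset R}), [/\ A2 `<=` A1,
    forall z, (z \in Z) = (z \in dilate_floor delta A2 d),
    #|` A1|%:R <= harmonic_sum R #|` A| * #|` A2|%:R,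
    #|` Z +f Z|%:R * #|` A1|%:R
      <= 3 * harmonic_sum R #|` A| * #|` sum_floor delta A|%:R * #|` Z|%:R
    & #|` A1|%:R * d `^ sigma <= harmonic_sum R #|` A| * C * #|` Z|%:R].
Proof.
move=> /andP[deltad d1]; have d0 : 0 < d := lt_le_trans delta0 deltad.
pose cell (x : R) := Num.floor (d * x / delta).
pose S := dilate_floor delta A1 d.
pose n q := #|` [fset x in A1 | cell x == q]|.
have cA1A : (#|` A1| <= #|` A|)%N by apply: fsubset_leq_card.
have cA : (0 < #|` A|)%N by apply: leq_trans cA1A; rewrite cardfs_gt0.
have nA q : q \in S -> (n q <= #|` A|)%N.
  move=> _; apply: leq_trans cA1A; apply: fsubset_leq_card.
  by apply/fsubsetP => x; rewrite !inE => /andP[].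
have [m [m0 mA hm]] := layer_cake R cA nA.
have sumn : (\sum_(q <- S) n q = #|` A1|)%N.
  rewrite /n; under eq_bigr do rewrite card_sep_sum.
  rewrite exchange_big /= card_fset_sum1 big_seq [RHS]big_seq; apply: eq_bigr => x xA1.
  by rewrite sum_eq_mem//; apply: in_dilate_floor.
rewrite sumn in hm.
pose Z := [fset q in S | (m <= n q)%N].
rewrite -/Z in hm.
pose A2 := [fset x in A1 | cell x \in Z].
have ell0 : 0 <= harmonic_sum R #|` A| by apply: sumr_ge0 => i _; rewrite invr_ge0.
have mZ : m%:R * #|` Z|%:R <= #|` A2|%:R :> R.
  rewrite -[leRHS]mul1r.
  apply: (@double_count _ _ _ Z A2 (fun q x => cell x == q)) => [q qZ|x xA2].
    rewrite ler_nat; apply: leq_trans (_ : n q <= _)%N.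
      by move: qZ; rewrite !inE => /andP[].
    apply: fsubset_leq_card; apply/fsubsetP => x; rewrite !inE /= => /andP[-> /eqP e].
    by rewrite e eqxx andbT; move: qZ; rewrite !inE.
  rewrite -[1]/(1%:R) ler_nat -(cardfs1 (cell x)); apply: fsubset_leq_card.
  by apply/fsubsetP => q; rewrite !inE /= => /andP[_ /eqP->].
have A2E : #|` A1|%:R <= harmonic_sum R #|` A| * #|` A2|%:R.
  by apply: le_trans hm _; rewrite ler_wpM2l.
exists Z, A2; split => //.
- by apply/fsubsetP => x; rewrite !inE => /andP[].
- move=> z; apply/idP/imfsetP => [zZ|[x /= + ->]]; last by rewrite inE => /andP[].
  have := zZ; rewrite {1}inE /= => /andP[/imfsetP[x /= xA1 e] _].
  by exists x => //; rewrite !inE /= xA1 /= /cell -e; move: zZ; rewrite !inE.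
(* A pair of cells is joined to the sums x + y with x in the first cell and y a
   fixed point of the second one. *)
- have ZZ : m%:R * #|` Z +f Z|%:R <= 3 * #|` sum_floor delta A|%:R :> R.
    apply: (@double_count _ _ _ (Z +f Z) (sum_floor delta A)
      (fun s t => (d * t%:~R - 2 < s%:~R) && (s%:~R < d * t%:~R + 1))) => [s|t _].
      move=> /fsumP[z [z' [zZ z'Z ->]]].
      have := z'Z; rewrite inE /= => /andP[/imfsetP[y /= yA1 ey] _].
      rewrite ler_nat; apply: leq_trans (_ : n z <= _)%N.
        by move: zZ; rewrite !inE => /andP[].
      apply: (@card_le_inj _ _ _ _ (fun x => Num.floor ((x + y) / delta))) => [x|x x'].
        rewrite !inE /= => /andP[xA1 /eqP ex].
        rewrite -ex ey; apply/andP; split.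
          by apply/imfset2P; exists x; rewrite /= ?A1A'//; exists y; rewrite /= ?A1A'.
        have [h1 h2] := floor_bounds (d * x / delta).
        have [h3 h4] := floor_bounds (d * y / delta).
        have [h5 h6] := floor_bounds ((x + y) / delta).
        have h7 : d * (Num.floor ((x + y) / delta))%:~R <= d * ((x + y) / delta).
          by rewrite ler_pM2l.
        have h8 : d * ((x + y) / delta) < d * ((Num.floor ((x + y) / delta))%:~R + 1).
          by rewrite ltr_pM2l.
        rewrite /cell intrD; apply/andP; split; lra.
      rewrite !inE /= => /andP[xA1 _] /andP[x'A1 _] /(floor_eq_dist delta0).
      rewrite opprD addrACA subrr addr0 => h.
      apply/eqP; apply: contraTT isT => /(Asep (A1A' xA1) (A1A' x'A1)).
      by rewrite leNgt h.
    apply: le_trans (_ : (3 * #|` [fset t]|)%N%:R <= 3); last by rewrite cardfs1.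
    rewrite ler_nat.
    apply: (@card_le_cover _ _ _ (fun t => Num.floor (d * t%:~R) - 1)) => s.
    rewrite !inE /= => /andP[_ /andP[h1 h2]]; exists t; rewrite ?inE//.
    have [h3 h4] := floor_bounds (d * t%:~R).
    by apply: (@int_between R); rewrite !(intrD, rmorphN) /=; lra.
  have c0 : 0 <= #|` Z +f Z|%:R :> R by [].
  apply: le_trans (ler_wpM2l c0 hm) _.
  have : harmonic_sum R #|` A| * #|` Z|%:R * (m%:R * #|` Z +f Z|%:R)
      <= harmonic_sum R #|` A| * #|` Z|%:R * (3 * #|` sum_floor delta A|%:R).
    by apply: ler_wpM2l ZZ; rewrite mulr_ge0.
  by move: (harmonic_sum R #|` A|) => l; lra.
- have dd : delta <= delta / d by rewrite ler_peMr ?(ltW delta0)// invf_ge1.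
  have ds0 : 0 < d `^ sigma by rewrite powR_gt0.
  have A2Z : #|` A2|%:R * d `^ sigma <= C * #|` Z|%:R.
    have : 1 * #|` A2|%:R <= C * (delta / d) `^ sigma * #|` A|%:R * #|` Z|%:R.
      apply: (@double_count _ _ _ A2 Z (fun x q => cell x == q)) => [x xA2|q _].
        rewrite -[1]/(1%:R) ler_nat -(cardfs1 (cell x)); apply: fsubset_leq_card.
        apply/fsubsetP => q; rewrite !inE /= => /eqP->.
        by move: xA2; rewrite !inE eqxx => /andP[_ ->].
      apply: le_trans (Afrost (q%:~R * (delta / d)) dd).
      rewrite ler_nat; apply: fsubset_leq_card; apply/fsubsetP => x.
      rewrite !inE /= => /andP[/andP[/A1A'-> _] /eqP e] /=.
      have [h1 h2] := floor_bounds (d * x / delta).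
      move: h1 h2; rewrite -/(cell x) e => h1 h2.
      have xE : x = (d * x / delta) * (delta / d) by field; rewrite !gt_eqF.
      have eta0 : 0 < delta / d by rewrite divr_gt0.
      move: (ler_wpM2r (ltW eta0) h1) (ler_wpM2r (ltW eta0) (ltW h2)).
      by rewrite -xE => -> /=; rewrite mulrDl mul1r.
    rewrite mul1r => /(ler_wpM2r (ltW ds0)) h; apply: le_trans h _.
    rewrite le_eqVlt; apply/orP; left; apply/eqP.
    have e : (delta / d) `^ sigma * d `^ sigma * #|` A|%:R = 1.
      rewrite -powRM ?divfK ?gt_eqF ?divr_ge0 ?ltW// Acard powRN mulfV//.
      by rewrite gt_eqF// powR_gt0.
    transitivity (C * ((delta / d) `^ sigma * d `^ sigma * #|` A|%:R) * #|` Z|%:R).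
      by ring.
    by rewrite e mulr1.
  apply: le_trans (ler_wpM2r (ltW ds0) A2E) _.
  by rewrite -!mulrA ler_wpM2l.
Qed.

(** Depending on whether d1' / (2 d) is b / 2 or (b + 1) / 2, the combination
    2 d y + d1' x uses one or no superfluous copy of Z. *)
Lemma card_combo_cover (d1 d d1' : R) (A2 Y : {fset R}) (Z Z' W : {fset int}) :
  d1' = d1 \/ d1' = d1 + d -> Z != fset0 ->
  (forall x, x \in A2 -> Num.floor (d * x / delta) \in Z) ->
  (forall y, y \in Y -> Num.floor (d * y / delta) \in Z') -> Z' `<=` Z ->
  (forall x, x \in A2 -> Num.floor (d1 * x / delta) \in W) ->
  (#|` [fset Num.floor ((2 * d * y + d1' * x) / delta) | y in Y, x in A2]|
    <= 4 * #|` Z' +f Z +f Z +f W|)%N.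
Proof.
move=> d1E /fset0Pn[z0 z0Z] AZ YZ Z'Z AW.
case: d1E => ->.
  apply: (@card_le_cover _ _ _ (fun q => q - z0)) => _ /imfset2P[y /= yY [x /= xA ->]].
  exists (Num.floor (d * y / delta) + Num.floor (d * y / delta) + z0
    + Num.floor (d1 * x / delta)).
    by rewrite !in_fsum// ?AW// ?(fsubsetP Z'Z)// YZ.
  have [h1 h2] := floor_bounds (d * y / delta).
  have [h3 h4] := floor_bounds (d1 * x / delta).
  have [h5 h6] := floor_bounds ((2 * d * y + d1 * x) / delta).
  have E : (2 * d * y + d1 * x) / delta
    = d * y / delta + d * y / delta + d1 * x / delta by ring.
  rewrite E in h5 h6 *.
  by apply: (@int_between R); rewrite !(intrD, rmorphN) /=; lra.
apply: (@card_le_cover _ _ _ id) => _ /imfset2P[y /= yY [x /= xA ->]].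
exists (Num.floor (d * y / delta) + Num.floor (d * y / delta)
    + Num.floor (d * x / delta) + Num.floor (d1 * x / delta)).
  by rewrite !in_fsum ?(AW x xA) ?(AZ x xA) ?(YZ y yY) ?(fsubsetP Z'Z _ (YZ y yY)).
have [h1 h2] := floor_bounds (d * y / delta).
have [h3 h4] := floor_bounds (d1 * x / delta).
have [h5 h6] := floor_bounds ((2 * d * y + (d1 + d) * x) / delta).
have [h7 h8] := floor_bounds (d * x / delta).
have E : (2 * d * y + (d1 + d) * x) / delta
  = d * y / delta + d * y / delta + d * x / delta + d1 * x / delta by ring.
rewrite E in h5 h6 *.
by apply: (@int_between R); rewrite !(intrD, rmorphN) /=; lra.
Qed.

(** A collision with |x - x'| >= rho would produce a quotient within delta / rho^2
    of d1' / (2 d).  For the others, x' is within rho of x and the cell of y' is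
    determined up to two values; y' itself is then determined as Y meets each
    cell at most once. *)
Lemma isolated_collisions (d d1' rho : R) (A2 Y : {fset R}) (G : {fset int}) :
  delta <= rho -> rho <= d -> A2 `<=` A1 -> Y `<=` A1 ->
  {in Y &, injective (fun y => Num.floor (d * y / delta))} ->
  (forall x x' y y', x \in A1 -> x' \in A1 -> y \in A1 -> y' \in A1 ->
    rho <= `|x - x'| ->
    delta / rho ^+ 2 * `|x - x'| <= `|(y - y') + d1' / (2 * d) * (x - x')|) ->
  (forall x y, y \in Y -> x \in A2 -> Num.floor ((2 * d * y + d1' * x) / delta) \in G) ->
  0 < #|` Y|%:R :> R -> 0 < #|` A2|%:R :> R ->
  #|` Y|%:R * #|` A2|%:R <= #|` G|%:R * (4 * C * rho `^ sigma * #|` A|%:R).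
Proof.
move=> dr rd A2A1 YA1 Yinj iso YG Y0 A20.
have rho0 : 0 < rho := lt_le_trans delta0 dr.
have d0 : 0 < d := lt_le_trans rho0 rd.
pose coll y x y' x' :=
  Num.floor ((2 * d * y + d1' * x) / delta) == Num.floor ((2 * d * y' + d1' * x') / delta).
have collP y x y' x' : coll y x y' x' ->
    `|(y - y') + d1' / (2 * d) * (x - x')| < delta / (2 * d).
  have d20 : 0 < 2 * d by rewrite mulr_gt0.
  move=> /eqP/(floor_eq_dist delta0) h; rewrite ltr_pdivlMr//; apply: le_lt_trans h.
  rewrite -[X in _ * X](gtr0_norm d20) -normrM le_eqVlt; apply/orP; left; apply/eqP.
  by congr `|_|; field; rewrite gt_eqF.
have YG' y x : y \in Y -> x \in A2 -> Num.floor ((2 * d * y + d1' * x) / delta) \in G.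
  by move=> yY xA2; apply: YG.
have := collision YG'.
set Q := (\sum_(y <- Y) _)%N => col.
have QE : Q = (\sum_(y <- Y) \sum_(x <- A2) \sum_(x' <- A2) \sum_(y' <- Y) coll y x y' x')%N.
  apply: eq_bigr => y _; apply: eq_bigr => x _; exact: exchange_big.
have inner y x x' : y \in Y -> x \in A2 -> x' \in A2 ->
    (\sum_(y' <- Y) coll y x y' x')%:R <= 2 * (`|x - x'| < rho)%R%:R :> R.
  move=> yY xA x'A.
  have [near|far] := ltP `|x - x'| rho; last first.
    rewrite big1_seq ?mulr0// => y' /andP[_ y'Y]; apply/eqP; rewrite eqb0; apply/negP => /collP.
    apply/negP; rewrite -leNgt.
    have isol := iso x x' y y' (fsubsetP A2A1 _ xA) (fsubsetP A2A1 _ x'A)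
      (fsubsetP YA1 _ yY) (fsubsetP YA1 _ y'Y) far.
    apply: le_trans isol.
    apply: le_trans (_ : delta / rho ^+ 2 * rho <= _); last first.
      by rewrite ler_wpM2l// divr_ge0 ?exprn_ge0// ltW.
    have -> : delta / rho ^+ 2 * rho = delta / rho by field; rewrite gt_eqF.
    by rewrite ler_pM2l// lef_pV2 ?posrE ?mulr_gt0//; lra.
  rewrite -[leRHS]/(2 * 1) mulr1 ler_nat -card_sep_sum.
  pose v := d * y / delta + d1' * (x - x') / (2 * delta).
  apply: leq_trans (_ : #|` [fset Num.floor (d * y' / delta) | y' in
      [fset y' in Y | coll y x y' x']]| <= _)%N.
    apply: (@card_le_inj _ _ _ _ (fun y' => Num.floor (d * y' / delta))).
      by move=> y' y'S; apply/imfsetP; exists y'.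
    move=> y1 y2; rewrite !inE /= => /andP[y1Y _] /andP[y2Y _]; exact: Yinj.
  apply: leq_trans (_ : 2 * #|` [fset (0 : int)]| <= _)%N; last by rewrite cardfs1.
  apply: (@card_le_cover _ _ _ (fun=> Num.floor (v - 2^-1))) => _ /imfsetP[y' /= + ->].
  rewrite !inE /= => /andP[_ /collP h]; exists 0; rewrite ?inE//.
  have [h1 h2] := floor_bounds (v - 2^-1).
  have [h3 h4] := floor_bounds (d * y' / delta).
  have : `|v - d * y' / delta| < 2^-1.
    have -> : v - d * y' / delta = ((y - y') + d1' / (2 * d) * (x - x')) * (d / delta).
      by rewrite /v; field; rewrite !gt_eqF.
    rewrite normrM (gtr0_norm (divr_gt0 d0 delta0)).
    have -> : 2^-1 = delta / (2 * d) * (d / delta) by field; rewrite !gt_eqF.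
    by rewrite ltr_pM2r// divr_gt0.
  rewrite ltr_norml => /andP[h5 h6].
  by apply: (@int_between R); rewrite !(intrD, rmorphN) /=; lra.
have Qle : Q%:R <= 2 * (2 * C * rho `^ sigma * #|` A|%:R) * #|` A2|%:R * #|` Y|%:R :> R.
  rewrite QE natr_sum; apply: sum_le_card => y yY.
  rewrite natr_sum; apply: sum_le_card => x xA.
  rewrite natr_sum.
  apply: le_trans (_ : \sum_(x' <- A2) 2 * (`|x - x'| < rho)%R%:R <= _).
    by rewrite big_seq [leRHS]big_seq; apply: ler_sum => x' x'A; apply: inner.
  rewrite -mulr_sumr ler_wpM2l//.
  apply: le_trans (frostman_ball delta01 sigma01 C0 Afrost x dr).
  rewrite -natr_sum -card_sep_sum ler_nat; apply: fsubset_leq_card.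
  by apply/fsubsetP => z; rewrite !inE => /andP[/(fsubsetP A2A1)/A1A'-> ->].
have YA0 : 0 < #|` Y|%:R * #|` A2|%:R :> R by rewrite mulr_gt0.
rewrite -(ler_pM2r YA0).
apply: le_trans (_ : #|` G|%:R * Q%:R <= _).
  by rewrite -expr2 -!natrM -natrX ler_nat.
have := ler_wpM2l (ler0n R #|` G|) Qle; lra.
Qed.

(** With Z the dense cells at scale delta / d, the set Z' of [plunnecke_large]
    controls Z' + Z + Z + W, where W is the dilate of A2 by d1.  One point of A2
    is chosen in each cell of Z', and the collisions of 2 d y + d1' x on these
    points y and on all points x of A2 are rare. *)
Lemma isolated_quotient_bound (d1 d d1' rho K H : R) :
  delta <= rho -> rho <= d <= 1 -> d1' = d1 \/ d1' = d1 + d ->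
  #|` sum_floor delta A|%:R <= K * #|` A|%:R ->
  #|` combo_floor delta A d1 d|%:R <= H * d `^ sigma * #|` A|%:R ->
  (forall x x' y y', x \in A1 -> x' \in A1 -> y \in A1 -> y' \in A1 ->
    rho <= `|x - x'| ->
    delta / rho ^+ 2 * `|x - x'| <= `|(y - y') + d1' / (2 * d) * (x - x')|) ->
  #|` A1|%:R ^+ 4 <= 9 * 2 ^+ 12 * C ^+ 2 * rho `^ sigma * harmonic_sum R #|` A| ^+ 4
    * K ^+ 2 * #|` A|%:R ^+ 4 * H.
Proof.
move=> dr /andP[rd dle1] d1E sumK comboH iso.
have rho0 : 0 < rho := lt_le_trans delta0 dr.
have d0 : 0 < d := lt_le_trans rho0 rd.
have ds0 : 0 < d `^ sigma by rewrite powR_gt0.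
have deltad : delta <= d <= 1 by rewrite dle1 (le_trans dr).
have [Z [A2 [A2A1 ZE A2big ZZ Zbig]]] := uniform_scale deltad.
have N1 : 0 < #|` A1|%:R :> R by rewrite ltr0n cardfs_gt0.
have N0 : 0 < #|` A|%:R :> R.
  by apply: lt_le_trans N1 _; rewrite ler_nat; apply: fsubset_leq_card.
set ell := harmonic_sum R #|` A| in A2big ZZ Zbig *.
have ell0 : 0 <= ell by apply: sumr_ge0 => i _; rewrite invr_ge0.
have n2 : 0 < #|` A2|%:R :> R.
  rewrite lt0r ler0n andbT; apply: contraTneq A2big => ->.
  by rewrite mulr0 -ltNge.
have [x0 x0A2] : exists x, x \in A2.
  by apply/fset0Pn; rewrite -cardfs_gt0 -(ltr0n R).
have AZ x : x \in A2 -> Num.floor (d * x / delta) \in Z.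
  by move=> xA; rewrite ZE in_dilate_floor.
have Z0 : Z != fset0 by apply/fset0Pn; exists (Num.floor (d * x0 / delta)); apply: AZ.
have a0 : 0 < #|` Z|%:R :> R by rewrite ltr0n cardfs_gt0.
pose W := dilate_floor delta A2 d1.
have W0 : W != fset0 by apply/fset0Pn; exists (Num.floor (d1 * x0 / delta)); apply: in_dilate_floor.
have ZWle : #|` Z +f W|%:R <= 2 * (H * d `^ sigma * #|` A|%:R).
  apply: le_trans (_ : 2 * #|` combo_floor delta A d1 d|%:R <= _); last first.
    exact: ler_wpM2l.
  rewrite -natrM ler_nat.
  apply: (@card_le_cover _ _ _ (fun q => q - 1)) => _ /fsumP[z [w [+ + ->]]].
  rewrite ZE => /imfsetP[y /= yA ->] /imfsetP[x /= xA ->].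
  exists (Num.floor ((d1 * x + d * y) / delta)).
    by apply/imfset2P; exists x; rewrite /= ?A1A' ?(fsubsetP A2A1)//;
      exists y; rewrite /= ?A1A' ?(fsubsetP A2A1).
  have [h1 h2] := floor_bounds (d * y / delta).
  have [h3 h4] := floor_bounds (d1 * x / delta).
  have [h5 h6] := floor_bounds ((d1 * x + d * y) / delta).
  have E : (d1 * x + d * y) / delta = d1 * x / delta + d * y / delta by ring.
  rewrite E in h5 h6 *.
  by apply: (@int_between R); rewrite !(intrD, rmorphN) /=; lra.
pose k1 : R := #|` Z +f Z|%:R / #|` Z|%:R.
pose k2 : R := #|` Z +f W|%:R / #|` Z|%:R.
have k10 : 0 < k1 by rewrite divr_gt0// ltr0n cardfs_gt0 fsum_neq0.
have k20 : 0 < k2 by rewrite divr_gt0// ltr0n cardfs_gt0 fsum_neq0.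
have [||Z' [Z'Z Z'big Z'sum]] := @plunnecke_large R _ Z W k1 k2 k10 k20.
- by rewrite divfK ?gt_eqF.
- by rewrite divfK ?gt_eqF.
have /choice[rep repP] : forall z, exists y, z \in Z' -> y \in A2 /\ Num.floor (d * y / delta) = z.
  move=> z; have [/(fsubsetP Z'Z)|_] := boolP (z \in Z'); last by exists 0.
  by rewrite ZE => /imfsetP[y /= yA ->]; exists y.
pose Y := [fset rep z | z in Z'].
have cY : #|` Y| = #|` Z'|.
  rewrite card_in_imfset//= => z z' zZ z'Z e.
  by have [_ <-] := repP z zZ; have [_ <-] := repP z' z'Z; rewrite e.
have YA1 : Y `<=` A1.
  by apply/fsubsetP => _ /imfsetP[z /= zZ ->]; apply: (fsubsetP A2A1); have [] := repP z zZ.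
have YZ y : y \in Y -> Num.floor (d * y / delta) \in Z'.
  by move=> /imfsetP[z /= zZ ->]; have [_ ->] := repP z zZ.
have Yinj : {in Y &, injective (fun y => Num.floor (d * y / delta))}.
  move=> _ _ /imfsetP[z /= zZ ->] /imfsetP[z' /= z'Z ->].
  by have [_ ->] := repP z zZ; have [_ ->] := repP z' z'Z => ->.
pose G := [fset Num.floor ((2 * d * y + d1' * x) / delta) | y in Y, x in A2].
have YG x y : y \in Y -> x \in A2 -> Num.floor ((2 * d * y + d1' * x) / delta) \in G.
  by move=> yY xA; apply/imfset2P; exists y => //; exists x.
have Ypos : 0 < #|` Y|%:R :> R.
  have : 0 < 2 * #|` Z'|%:R :> R by apply: lt_le_trans Z'big.
  by rewrite cY; lra.
have low := isolated_collisions dr rd A2A1 YA1 Yinj iso YG Ypos n2.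
have AW x : x \in A2 -> Num.floor (d1 * x / delta) \in W by apply: in_dilate_floor.
have Gle : #|` G|%:R <= 512 * k1 ^+ 2 * (H * d `^ sigma * #|` A|%:R).
  apply: le_trans (_ : 4 * #|` Z' +f Z +f Z +f W|%:R <= _).
    by rewrite -natrM ler_nat; apply: card_combo_cover d1E Z0 AZ YZ Z'Z AW.
  have e : k2 * #|` Z|%:R = #|` Z +f W|%:R by rewrite divfK ?gt_eqF.
  rewrite -mulrA e in Z'sum.
  have := ler_wpM2l (mulr_ge0 (ler0n R 64) (exprn_ge0 2 (ltW k10))) ZWle.
  move: Z'sum; lra.
have k1N : k1 * #|` A1|%:R <= 3 * ell * K * #|` A|%:R.
  rewrite -(ler_pM2r a0).
  have -> : k1 * #|` A1|%:R * #|` Z|%:R = #|` Z +f Z|%:R * #|` A1|%:R.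
    by rewrite mulrAC divfK ?gt_eqF.
  apply: le_trans ZZ _; rewrite ler_pM2r//.
  have := ler_wpM2l (mulr_ge0 (ler0n R 3) ell0) sumK; lra.
rewrite -(ler_pM2r ds0).
set u : R := #|` A1|%:R in N1 A2big Zbig k1N *.
set N : R := #|` A|%:R in N0 low Gle k1N *.
set HD := H * d `^ sigma * N in Gle.
have P0 : 0 < rho `^ sigma by rewrite powR_gt0.
have HD0 : 0 <= HD.
  by have := le_trans (ler0n _ _) ZWle; rewrite pmulr_rge0.
have step1 : u * (u * d `^ sigma) <= ell * #|` A2|%:R * (ell * C * (2 * #|` Y|%:R)).
  apply: ler_pM => //; rewrite ?mulr_ge0 ?(ltW N1) ?(ltW ds0)//.
  apply: le_trans Zbig _; rewrite ler_wpM2l ?mulr_ge0 ?(ltW C0)//.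
  by rewrite cY.
have step2 : #|` Y|%:R * #|` A2|%:R <= 512 * k1 ^+ 2 * HD * (4 * C * rho `^ sigma * N).
  apply: le_trans low _; rewrite ler_wpM2r//.
  by rewrite !mulr_ge0 ?(ltW C0) ?(ltW P0) ?(ltW N0).
have q0 : 0 <= 2 * ell ^+ 2 * C by rewrite !mulr_ge0 ?exprn_ge0 ?(ltW C0).
have step3 : u * (u * d `^ sigma) <= 2 * ell ^+ 2 * C
    * (512 * k1 ^+ 2 * HD * (4 * C * rho `^ sigma * N)).
  apply: le_trans (ler_wpM2l q0 step2); apply: le_trans step1 _.
  by rewrite le_eqVlt; apply/orP; left; apply/eqP; ring.
have ku0 : 0 <= k1 * u by rewrite mulr_ge0 ?ltW.
have step4 : (k1 * u) ^+ 2 <= (3 * ell * K * N) ^+ 2.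
  by rewrite ler_sqr ?nnegrE// (le_trans ku0).
have r0 : 0 <= 2 ^+ 12 * ell ^+ 2 * C ^+ 2 * rho `^ sigma * N * HD.
  apply: mulr_ge0 => //.
  by rewrite !mulr_ge0 ?exprn_ge0 ?(ltW C0) ?(ltW P0) ?(ltW N0).
have step5 := ler_wpM2l (exprn_ge0 2 (ltW N1)) step3.
have step6 := ler_wpM2l r0 step4.
have -> : u ^+ 4 * d `^ sigma = u ^+ 2 * (u * (u * d `^ sigma)) by ring.
apply: le_trans step5 _.
apply: le_trans (_ : 2 ^+ 12 * ell ^+ 2 * C ^+ 2 * rho `^ sigma * N * HD * (k1 * u) ^+ 2 <= _).
  by rewrite le_eqVlt; apply/orP; left; apply/eqP; ring.
apply: le_trans step6 _.
by rewrite le_eqVlt; apply/orP; left; apply/eqP; rewrite /HD; ring.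
Qed.
End Sparse.

(** * Dense or isolated quotients *)

Section Dichotomy.
Local Open Scope fset_scope.
Local Open Scope ring_scope.
Variables (R : realType) (delta sigma C : R) (A : {fset R}).
Hypothesis delta01 : 0 < delta < 1.
Hypothesis sigma01 : 0 < sigma < 1.
Hypothesis C0 : 0 < C.
Hypothesis A12 : forall x, x \in A -> 1 <= x <= 2.
Hypothesis Asep : forall x y, x \in A -> y \in A -> x != y -> delta <= `|x - y|.
Hypothesis Afrost : frostman delta sigma C A.
Hypothesis Acard : #|` A|%:R = delta `^ (- sigma).

Let delta0 : 0 < delta. Proof. by case/andP: delta01. Qed.
Let N0 : 0 < #|` A|%:R :> R. Proof. by rewrite Acard powR_gt0. Qed.
Let cA : (0 < #|` A|)%N. Proof. by rewrite -(ltr0n R). Qed.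

Lemma frostman_constant_ge1 : 1 <= C.
Proof.
have := Afrost 1 (ltW (proj2 (andP delta01))).
rewrite powR1 mulr1 -{1}[#|` [fset x in A | _]|%:R]mul1r => h.
rewrite -(ler_pM2r N0); apply: le_trans h; rewrite !mul1r ler_nat.
apply: fsubset_leq_card; apply/fsubsetP => x xA; rewrite !inE /= xA.
by have /andP[-> h] := A12 xA; lra.
Qed.

Lemma card_prod_floor_ge : (#|` A| <= #|` prod_floor delta A|)%N.
Proof.
have [a aA] : exists a, a \in A by apply/fset0Pn; rewrite -cardfs_gt0.
have /andP[a1 _] := A12 aA.
rewrite -(card_dilate_floor delta0 Asep a1); apply: fsubset_leq_card.
by apply/fsubsetP => _ /imfsetP[x /= xA ->]; apply/imfset2P; exists a => //; exists x.
Qed.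

Variables (A1 : {fset R}) (rho : R).

Definition quotient (b : R) := exists a1 a2 a3 a4,
  [/\ a1 \in A1, a2 \in A1, a3 \in A1 & a4 \in A1] /\
  (rho <= a3 - a4 /\ a1 - a2 = b * (a3 - a4)).

Hypothesis A1A : A1 `<=` A.
Hypothesis A10 : A1 != fset0.
Hypothesis rhoP : delta <= rho <= 1.
Variable H : R.
Hypothesis H0 : 0 <= H.
Hypothesis comboH : forall a1 a2 a3 a4,
  a1 \in A1 -> a2 \in A1 -> a3 \in A1 -> a4 \in A1 ->
  0 <= a1 - a2 <= a3 - a4 -> delta <= a3 - a4 ->
  #|` combo_floor delta A (a1 - a2) (a3 - a4)|%:R
    <= H * (a3 - a4) `^ sigma * #|` A|%:R.

Let rho0 : 0 < rho. Proof. by case/andP: rhoP => /(lt_le_trans delta0). Qed.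
Let A1A' x : x \in A1 -> x \in A. Proof. exact: (fsubsetP A1A). Qed.
Let diff_le1 x y : x \in A1 -> y \in A1 -> x - y <= 1.
Proof.
by move=> /A1A'/A12/andP[? ?] /A1A'/A12/andP[? ?]; lra.
Qed.

Lemma quotient_sparse (K b c : R) :
  #|` sum_floor delta A|%:R <= K * #|` A|%:R ->
  quotient b -> 0 <= b <= 1 -> c = b / 2 \/ c = (b + 1) / 2 ->
  (forall b', quotient b' -> delta / rho ^+ 2 < `|b' - c|) ->
  #|` A1|%:R ^+ 4 <= 9 * 2 ^+ 12 * C ^+ 2 * rho `^ sigma * harmonic_sum R #|` A| ^+ 4
    * K ^+ 2 * #|` A|%:R ^+ 4 * H.
Proof.
move=> sumK [a1 [a2 [a3 [a4 [[a1A a2A a3A a4A] [rd e]]]]]] /andP[b0 b1] cE far.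
have /andP[dr r1] := rhoP.
set d := a3 - a4 in rd e; have d0 : 0 < d := lt_le_trans rho0 rd.
have d1d : 0 <= a1 - a2 <= d by rewrite e mulr_ge0 ?(ltW d0)//= ler_piMl ?(ltW d0).
pose d1' := c * (2 * d).
have cE' : d1' / (2 * d) = c by rewrite mulfK// gt_eqF// mulr_gt0.
apply: (@isolated_quotient_bound R delta sigma C A A1 delta01 sigma01 C0 Asep Afrost Acard A1A A10
  (a1 - a2) d d1' rho K H) => //.
- by rewrite rd diff_le1.
- by rewrite /d1' e; case: cE => ->; [left|right]; field.
- by apply: comboH => //; apply: le_trans rd.
move=> x x' y y' xA x'A yA y'A xx; rewrite cE'.
have xx0 : 0 < `|x - x'| by apply: lt_le_trans xx.
have xne : x - x' != 0 by rewrite -normr_gt0.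
pose b' := (y' - y) / (x - x').
have qb' : quotient b'.
  move: xx; rewrite ler_normr => /orP[xx|xx].
    exists y', y, x, x'; split => //; split => //.
    by rewrite /b' divfK.
  exists y, y', x', x; split => //; rewrite opprB in xx; split => //.
  by rewrite /b'; field.
have -> : (y - y') + c * (x - x') = - (b' - c) * (x - x').
  by rewrite /b'; field.
by rewrite normrM normrN ler_pM2r// ltW// far.
Qed.

(** The points 9 eps j of [0, 1] are 3 eps-close to quotients, which are then
    3 eps-separated. *)
Lemma quotient_dense :
  (forall t, 0 <= t <= 1 ->
    exists b, [/\ quotient b, 0 <= b <= 1 & `|t - b| <= 3 * (delta / rho ^+ 2)]) ->
  rho ^+ 2 <= 18 * delta * #|` A|%:R * H \/ 1 <= 8 * C ^+ 2 * rho `^ sigma * H.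
Proof.
move=> dens; set eps := delta / rho ^+ 2 in dens.
have eps0 : 0 < eps by rewrite divr_gt0// exprn_gt0.
have epsE : eps = delta / rho ^+ 2 by [].
clearbody eps.
have /andP[dr r1] := rhoP.
have [J [J1 J2]] : exists J : nat,
    (forall j, (j < J)%N -> 9 * eps * j%:R <= 1) /\ 1 <= 9 * eps * J%:R.
  have e9 : 0 < 9 * eps by rewrite mulr_gt0.
  have x0 : 0 <= (9 * eps)^-1 by rewrite invr_ge0 ltW.
  exists (Num.truncn (9 * eps)^-1).+1; split => [j|].
    rewrite ltnS => jJ; rewrite -ler_pdivlMl// mulr1.
    apply: le_trans (_ : (Num.truncn (9 * eps)^-1)%:R <= _); first by rewrite ler_nat.
    by rewrite truncn_le.
  by rewrite -ler_pdivrMl// mulr1 ltW// truncnS_gt.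
have /choice[a aP] : forall j : 'I_J, exists a : R * R * (R * R),
    [/\ a.1.1 \in A1, a.1.2 \in A1, a.2.1 \in A1 & a.2.2 \in A1] /\
    [/\ rho <= a.2.1 - a.2.2, 0 <= a.1.1 - a.1.2 <= a.2.1 - a.2.2 &
      `|9 * eps * j%:R - (a.1.1 - a.1.2) / (a.2.1 - a.2.2)| <= 3 * eps].
  move=> j; have [|b [[a1 [a2 [a3 [a4 [mem [rd e]]]]]] /andP[b0 b1] tb]] :=
    dens (9 * eps * (j : nat)%:R).
    by rewrite (J1 j (ltn_ord j)) andbT mulr_ge0// mulr_ge0// ltW.
  have d0 : 0 < a3 - a4 := lt_le_trans rho0 rd.
  exists ((a1, a2), (a3, a4)); split => //=; split => //.
    by rewrite e mulr_ge0 ?(ltW d0)//= ler_piMl ?(ltW d0).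
  by rewrite e mulfK// gt_eqF.
pose d j := (a j).2.1 - (a j).2.2; pose d1 j := (a j).1.1 - (a j).1.2.
have J0 : 0 < J%:R :> R.
  rewrite ltr0n lt0n; apply: contraTneq J2 => ->.
  by rewrite mulr0 -ltNge.
have main : J%:R <= H * (#|` A|%:R + 4 * C ^+ 2 * rho `^ sigma * J%:R).
  apply: (@separated_quotients_bound R delta sigma C A delta01 sigma01 C0 Afrost Acard J d1 d rho H) => //.
  - by move=> j; have [[h1 h2 h3 h4] [-> _ _]] := aP j; rewrite diff_le1.
  - by move=> j; have [_ []] := aP j.
  - move=> i j ij.
    have [_ [_ _]] := aP i; have [_ [_ _]] := aP j; rewrite -/(d i) -/(d j) -/(d1 i) -/(d1 j).
    have : 9 * eps * 1 <= 9 * eps * `|i%:R - j%:R|.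
      rewrite ler_wpM2l// ?mulr_ge0 ?(ltW eps0)//.
      have : ((i : nat) != j) by [].
      rewrite neq_ltn => /orP[lt|lt].
        by rewrite distrC -natrB ?(ltnW lt)// ger0_norm// ler1n subn_gt0.
      by rewrite -natrB ?(ltnW lt)// ger0_norm// ler1n subn_gt0.
    have e9 : 0 <= 9 * eps by rewrite mulr_ge0 ?(ltW eps0).
    rewrite -{2}(ger0_norm e9) -normrM mulrBr mulr1.
    have -> : 2 * delta / rho ^+ 2 = 2 * eps by rewrite epsE; ring.
    move: (9 * eps * _) (9 * eps * _) (d1 i / d i) (d1 j / d j) => u v p q.
    move=> huv; rewrite !ler_norml => /andP[h1 h2] /andP[h3 h4].
    rewrite ler_normr; move: huv; rewrite ler_normr => /orP[huv|huv]; apply/orP.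
      by left; lra.
    by right; lra.
  - move=> j; have [[h1 h2 h3 h4] [h5 h6 h7]] := aP j; apply: comboH => //.
    exact: le_trans h5.
have [big|small] := leP (2 * H * #|` A|%:R) J%:R.
  right; rewrite -(ler_pM2r J0); move: main big; lra.
left.
have : 1 <= 9 * eps * (2 * H * #|` A|%:R).
  by apply: le_trans J2 _; rewrite ler_wpM2l ?(ltW small)// mulr_ge0 ?(ltW eps0).
have r2 : 0 < rho ^+ 2 by rewrite exprn_gt0.
rewrite -(ler_pM2r r2) mul1r.
by have -> : 9 * eps * (2 * H * #|` A|%:R) * rho ^+ 2 = 18 * delta * #|` A|%:R * H
  by rewrite epsE; field; rewrite gt_eqF.
Qed.
End Dichotomy.

(** * The discretised sum-product dichotomy *)

Lemma monomial_le (R : realDomainType) (c l k : R) (i i' j j' m m' : nat) :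
  1 <= c -> 1 <= l -> 1 <= k -> (i <= i')%N -> (j <= j')%N -> (m <= m')%N ->
  c ^+ i * l ^+ j * k ^+ m <= c ^+ i' * l ^+ j' * k ^+ m'.
Proof.
move=> c1 l1 k1 ii jj mm.
have [c0 l0 k0] : [/\ 0 <= c, 0 <= l & 0 <= k] by split; apply: le_trans ler01 _.
by apply: ler_pM; rewrite ?mulr_ge0 ?exprn_ge0 ?ler_weXn2l//; apply: ler_pM;
  rewrite ?exprn_ge0 ?ler_weXn2l.
Qed.

Section DiscretisedSumProduct.
Local Open Scope fset_scope.
Local Open Scope ring_scope.
Variables (R : realType) (delta sigma C : R) (A : {fset R}).
Hypothesis delta01 : 0 < delta < 1.
Hypothesis sigma01 : 0 < sigma < 1.
Hypothesis C0 : 0 < C.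
Hypothesis A12 : forall x, x \in A -> 1 <= x <= 2.
Hypothesis Asep : forall x y, x \in A -> y \in A -> x != y -> delta <= `|x - y|.
Hypothesis Afrost : frostman delta sigma C A.
Hypothesis Acard : #|` A|%:R = delta `^ (- sigma).

Let delta0 : 0 < delta. Proof. by case/andP: delta01. Qed.
Let N0 : 0 < #|` A|%:R :> R. Proof. by rewrite Acard powR_gt0. Qed.
Let cA : (0 < #|` A|)%N. Proof. by rewrite -(ltr0n R). Qed.

(** The two alternatives correspond to an isolated and to a dense set of
    quotients.  With x = N / t and y = N / #A1 one has k = 16 K^2 x and
    x y <= K l, where l is the harmonic sum.  The isolated case costs
    K^2 y^4 k^4, which is of order K^10 (x y)^4 and at most K^14 l^4; the dense
    case costs k^4, which is at most of order K^12 l^4. *)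
Lemma discretised_dichotomy (K rho : R) :
  #|` sum_floor delta A|%:R <= K * #|` A|%:R ->
  #|` prod_floor delta A|%:R <= K * #|` A|%:R ->
  delta <= rho <= 1 ->
  1 <= 45 * 2 ^+ 38 * (C ^+ 3 * harmonic_sum R #|` A| ^+ 8 * K ^+ 14) * rho `^ sigma \/
  rho ^+ 2 <= 90 * 2 ^+ 26 * (C ^+ 1 * harmonic_sum R #|` A| ^+ 4 * K ^+ 12)
    * (delta * #|` A|%:R).
Proof.
move=> sumK prodK rhoP; have /andP[dr r1] := rhoP.
have rho0 : 0 < rho := lt_le_trans delta0 dr.
have A0 : A != fset0 by rewrite -cardfs_gt0.
have C1 := frostman_constant_ge1 delta01 A12 Afrost Acard.
have ell1 := @harmonic_sum_ge1 R _ cA.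
set ell := harmonic_sum R #|` A| in ell1 *.
have K1 : 1 <= K.
  rewrite -(ler_pM2r N0) mul1r; apply: le_trans prodK.
  by rewrite ler_nat; exact: (card_prod_floor_ge delta01 A12 Asep Acard).
have K0 : 0 < K := lt_le_trans ltr01 K1.
have ell0 : 0 < ell := lt_le_trans ltr01 ell1.
have [b [t [bA /andP[t0 tA] popular]]] := popular_dilate delta0 A12 Asep A0.
set A1 := [fset a in A | _] in popular.
have A1A : A1 `<=` A by apply/fsubsetP => a; rewrite !inE => /andP[].
have tR : 0 < t%:R :> R by rewrite ltr0n.
set N : R := #|` A|%:R in sumK prodK popular *.
have Npos : 0 < N := N0.
set N1 : R := #|` A1|%:R in popular.
have N2le : N ^+ 2 <= K * ell * (t%:R * N1).
  rewrite -(ler_pM2r Npos) -exprSr; apply: le_trans popular _.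
  have -> : K * ell * (t%:R * N1) * N = (K * N) * ell * (t%:R * N1) by ring.
  by apply: ler_wpM2r; rewrite ?mulr_ge0//; apply: ler_wpM2r => //; apply: ltW.
have N10 : 0 < N1.
  rewrite lt0r ler0n andbT; apply: contraTneq N2le => ->.
  by rewrite !mulr0 -ltNge exprn_gt0.
have A10 : A1 != fset0 by rewrite -cardfs_gt0 -(ltr0n R).
pose x := N / t%:R; pose y := N / N1.
have x1 : 1 <= x by rewrite ler_pdivlMr// mul1r ler_nat.
have y1 : 1 <= y.
  by rewrite ler_pdivlMr// mul1r ler_nat; apply: fsubset_leq_card.
have xy : x * y <= K * ell.
  have -> : x * y = N ^+ 2 / (t%:R * N1) by rewrite /x /y; field; rewrite !gt_eqF.
  by rewrite ler_pdivrMr// mulr_gt0.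
have xK : x <= K * ell by apply: le_trans xy; rewrite ler_peMr// (le_trans ler01).
have yK : y <= K * ell by apply: le_trans xy; rewrite ler_peMl// (le_trans ler01).
have [x0 y0] : 0 <= x /\ 0 <= y by split; apply: le_trans ler01 _.
have xy0 : 0 <= x * y by apply: mulr_ge0.
have Kell0 : 0 <= K * ell by apply: mulr_ge0; apply: ltW.
have P0 : 0 <= rho `^ sigma by apply: powR_ge0.
pose k := 16 * K ^+ 2 * x.
have sums a : a \in A1 ->
    #|` dilate_floor delta A b +f dilate_floor delta A a|%:R <= k * N /\
    #|` dilate_floor delta A b +f fopp (dilate_floor delta A a)|%:R <= k * N.
  rewrite !inE /= => /andP[aA ta].
  have [h1 h2] := card_dilate_sums A12 aA bA ta t0.
  have S2 : 16 * #|` sum_floor delta A|%:R ^+ 2 <= k * N * t%:R.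
    have -> : k * N * t%:R = 16 * (K * N) ^+ 2 by rewrite /k /x; field; rewrite gt_eqF.
    by rewrite ler_wpM2l// ler_sqr ?nnegrE ?mulr_ge0 ?(ltW K0) ?(ltW Npos).
  by split; rewrite -(ler_pM2r tR) -natrM; apply: le_trans S2;
    rewrite -natrX -natrM ler_nat.
pose H := 5 * 2 ^+ 10 * k ^+ 4 * C.
have k0 : 0 <= k by rewrite !mulr_ge0 ?exprn_ge0 ?(ltW K0).
have H0 : 0 <= H.
  apply: mulr_ge0 (ltW C0); apply: mulr_ge0; last exact: exprn_ge0.
  by rewrite mulr_ge0 ?exprn_ge0.
have HE : H = 5 * 2 ^+ 26 * K ^+ 8 * C * x ^+ 4 by rewrite /H /k; ring.
have A1A' a : a \in A1 -> a \in A by apply: (fsubsetP A1A).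
have comboH a1 a2 a3 a4 : a1 \in A1 -> a2 \in A1 -> a3 \in A1 -> a4 \in A1 ->
    0 <= a1 - a2 <= a3 - a4 -> delta <= a3 - a4 ->
    #|` combo_floor delta A (a1 - a2) (a3 - a4)|%:R <= H * (a3 - a4) `^ sigma * N.
  move=> a1A a2A a3A a4A d1d dd.
  have [s1 _] := sums _ a1A; have [_ s2] := sums _ a2A.
  have [s3 _] := sums _ a3A; have [_ s4] := sums _ a4A.
  exact: (card_combo_floor delta01 sigma01 C0 A12 Asep Afrost bA (A1A' _ a1A) (A1A' _ a2A)
    (A1A' _ a3A) (A1A' _ a4A) s1 s2 s3 s4 d1d dd).
have sparse_end : N1 ^+ 4 <= 9 * 2 ^+ 12 * C ^+ 2 * rho `^ sigma * ell ^+ 4 * K ^+ 2 * N ^+ 4 * H ->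
    1 <= 45 * 2 ^+ 38 * (C ^+ 3 * ell ^+ 8 * K ^+ 14) * rho `^ sigma.
  move=> h.
  have N14 : 0 < N1 ^+ 4 by rewrite exprn_gt0.
  have {h} : 1 <= 45 * 2 ^+ 38 * C ^+ 3 * rho `^ sigma * ell ^+ 4 * K ^+ 10 * (x * y) ^+ 4.
    rewrite -(ler_pM2r N14) mul1r; apply: le_trans h _.
    by rewrite le_eqVlt; apply/orP; left; apply/eqP; rewrite HE /y; field; rewrite gt_eqF.
  have xy4 : (x * y) ^+ 4 <= (K * ell) ^+ 4.
    by rewrite lerXn2r ?nnegrE.
  have q0 : 0 <= 45 * 2 ^+ 38 * C ^+ 3 * rho `^ sigma * ell ^+ 4 * K ^+ 10.
    by rewrite !mulr_ge0 ?exprn_ge0 ?(ltW C0) ?(ltW K0) ?(ltW ell0).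
  move=> h; have := le_trans h (ler_wpM2l q0 xy4) => h'; apply: le_trans h' _.
  by rewrite le_eqVlt; apply/orP; left; apply/eqP; ring.
have absorb (c : R) (i j m : nat) : 0 <= c -> c <= 45 * 2 ^+ 38 ->
    (i <= 3)%N -> (j <= 8)%N -> (m <= 14)%N ->
    1 <= c * (C ^+ i * ell ^+ j * K ^+ m) * rho `^ sigma ->
    1 <= 45 * 2 ^+ 38 * (C ^+ 3 * ell ^+ 8 * K ^+ 14) * rho `^ sigma.
  move=> c0 cle ii jj mm h; apply: le_trans h _; apply: ler_wpM2r => //.
  apply: ler_pM => //; first by rewrite !mulr_ge0 ?exprn_ge0 ?(ltW C0) ?(ltW K0) ?(ltW ell0).
  exact: monomial_le.
have x4 : x ^+ 4 <= (K * ell) ^+ 4.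
  by rewrite lerXn2r ?nnegrE.
have Hle : H <= 5 * 2 ^+ 26 * (C ^+ 1 * ell ^+ 4 * K ^+ 12).
  rewrite HE; have q0 : 0 <= 5 * 2 ^+ 26 * K ^+ 8 * C.
    by rewrite !mulr_ge0 ?exprn_ge0 ?(ltW C0) ?(ltW K0).
  apply: le_trans (ler_wpM2l q0 x4) _.
  by rewrite le_eqVlt; apply/orP; left; apply/eqP; ring.
(* If A1 has no two points at distance rho, then it lies in a ball of radius rho,
   and the Frostman condition gives the first alternative. *)
have [[a3 [a4 [a3A a4A rd]]]|nopair] :=
    pselect (exists a3 a4, [/\ a3 \in A1, a4 \in A1 & rho <= a3 - a4]); last first.
  left; have [a aA1] := fset0Pn _ A10.
  apply: (absorb 2 1%N 1%N 1%N) => //; first by lra.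
  have : N1 <= 2 * C * rho `^ sigma * N.
    apply: le_trans (frostman_ball delta01 sigma01 C0 Afrost a dr).
    rewrite ler_nat; apply: fsubset_leq_card; apply/fsubsetP => z zA1.
    rewrite !inE /= A1A'//= ltNge; apply/negP; rewrite ler_normr => /orP[h|h]; apply: nopair.
      by exists a, z.
    by exists z, a; rewrite -opprB.
  have N1V : 0 <= N1^-1 by rewrite invr_ge0 ltW.
  move=> /(ler_wpM2r N1V); rewrite divff ?gt_eqF// => h.
  apply: le_trans h _; rewrite -[leLHS]mulrA -/y.
  have q0 : 0 <= 2 * C * rho `^ sigma by rewrite !mulr_ge0 ?(ltW C0).
  apply: le_trans (ler_wpM2l q0 yK) _.
  by rewrite le_eqVlt; apply/orP; left; apply/eqP; ring.
pose B := quotient A1 rho.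
have B0 : B 0 by exists a3, a3, a3, a4; rewrite subrr mul0r.
have B1 : B 1 by exists a3, a4, a3, a4; rewrite mul1r.
pose eps := delta / rho ^+ 2.
have eps0 : 0 < eps by rewrite divr_gt0// exprn_gt0.
have isolated (f : R -> R) : (forall u, f u = u / 2 \/ f u = (u + 1) / 2) ->
    ~ (forall u, B u -> 0 <= u <= 1 -> exists2 b', B b' & `|b' - f u| <= eps) ->
    1 <= 45 * 2 ^+ 38 * (C ^+ 3 * ell ^+ 8 * K ^+ 14) * rho `^ sigma.
  move=> fE /existsNP[u] /not_implyP[Bu] /not_implyP[u01 no]; apply: sparse_end.
  apply: (quotient_sparse delta01 sigma01 C0 A12 Asep Afrost Acard A1A A10 rhoP comboH
    sumK Bu u01 (fE u)) => b' Bb'.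
  by rewrite ltNge; apply/negP => h; apply: no; exists b'.
have [Bl|] := pselect (forall u, B u -> 0 <= u <= 1 ->
    exists2 b', B b' & `|b' - u / 2| <= eps); last first.
  by move=> h; left; apply: (isolated (fun u => u / 2)) => // u; left.
have [Br|] := pselect (forall u, B u -> 0 <= u <= 1 ->
    exists2 b', B b' & `|b' - (u + 1) / 2| <= eps); last first.
  by move=> h; left; apply: (isolated (fun u => (u + 1) / 2)) => // u; right.
have dens := dense_of_halving eps0 B0 B1 Bl Br.
have [h|h] := quotient_dense delta01 sigma01 C0 A12 Afrost Acard A1A rhoP H0 comboH dens.
  right; apply: le_trans h _.
  have q0 : 0 <= 18 * delta * N by rewrite !mulr_ge0 ?(ltW delta0).
  apply: le_trans (ler_wpM2l q0 Hle) _.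
  by rewrite le_eqVlt; apply/orP; left; apply/eqP; ring.
left; apply: (absorb (40 * 2 ^+ 26) 3%N 4%N 12%N) => //.
- rewrite -[38%N]/(12 + 26)%N exprD mulrA ler_wpM2r ?exprn_ge0//.
  by have : 1 <= 2 ^+ 12 :> R by [rewrite exprn_ege1// ler1n]; lra.
- apply: le_trans h _.
  have q0 : 0 <= 8 * C ^+ 2 * rho `^ sigma by rewrite !mulr_ge0 ?exprn_ge0 ?(ltW C0).
  apply: le_trans (ler_wpM2l q0 Hle) _.
  by rewrite le_eqVlt; apply/orP; left; apply/eqP; ring.
Qed.
End DiscretisedSumProduct.

(** * Covering numbers, exponents and the theorem *)

Lemma covering_number_ge_card (R : realType) (t : R) (X : set R) (F : {fset int}) :
  0 < t -> (forall p, p \in F -> exists2 x, X x & p = Num.floor (x / t)) ->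
  ((#|` F|%:R / 2)%:E <= covering_number t X)%E.
Proof.
move=> t0 FX; apply: le_ereal_inf_tmp => _ [n [I [It XI]] <-].
rewrite lee_fin ler_pdivrMr// -natrM ler_nat mulnC.
have /choice[a aP] : forall i, exists a, forall x, x \in I i -> a <= x <= a + t.
  move=> i; have [a [b1 [b2 ->]]] := It i; exists a => x.
  rewrite itv_boundlr /= => /andP[h1 h2]; apply/andP; split.
    by case: b1 h1 => //; rewrite bnd_simp// => /ltW.
  by case: b2 h2 => //; rewrite bnd_simp// => /ltW.
have <- : #|` [fset i in 'I_n]%fset| = n by rewrite card_finset card_ord.
apply: (@card_le_cover _ _ _ (fun i => Num.floor (a i / t))) => _ /FX[x /XI[i _ /= xI] ->].
exists i; first by rewrite inE.
have /andP[ax xa] := aP i x xI.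
have [h1 h2] := floor_bounds (a i / t); have [h3 h4] := floor_bounds (x / t).
have h5 : a i / t <= x / t by rewrite ler_pM2r// invr_gt0.
have h6 : x / t <= a i / t + 1.
  by rewrite -(divff (lt0r_neq0 t0)) -mulrDl ler_pM2r// invr_gt0.
by apply: (@int_between R); rewrite !(intrD, rmorphN) /=; lra.
Qed.

Section Exponents.
Variables (R : realType) (delta sigma : R).
Hypothesis delta01 : 0 < delta < 1.
Hypothesis sigma01 : 0 < sigma < 1.

Definition gain := sigma * (1 - sigma) / (4 * (7 + 3 * sigma)).
(** Chosen so that the two alternatives of [discretised_dichotomy] give the same
    bound on K: rho^(- sigma) = delta^(- 14 gain), and
    rho^2 / (delta N) = delta^(- 12 gain). *)
Definition rho_exponent := 7 * (1 - sigma) / (2 * (7 + 3 * sigma)).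

Let sigma0 : 0 < sigma. Proof. by case/andP: sigma01. Qed.
Let sigma1 : sigma < 1. Proof. by case/andP: sigma01. Qed.
Let delta0 : 0 < delta. Proof. by case/andP: delta01. Qed.
Let delta1 : delta < 1. Proof. by case/andP: delta01. Qed.

Lemma rho_exponent_bounds : 0 <= rho_exponent <= 1.
Proof.
have [s0 s1] := andP sigma01; have h : 0 < 2 * (7 + 3 * sigma) by lra.
by rewrite /rho_exponent divr_ge0 ?ler_pdivrMr//=; lra.
Qed.

Lemma rho_powR_sigma :
  ((delta `^ - gain) ^+ 14) * (delta `^ rho_exponent) `^ sigma = 1.
Proof.
rewrite -powR_mulrn ?powR_ge0// -!powRrM -powRD; last by rewrite (gt_eqF delta0) implybT.
rewrite (_ : _ + _ = 0) ?powRr0// /gain /rho_exponent; field; have [s0 s1] := andP sigma01; lra.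
Qed.

Lemma rho_sqr :
  (delta `^ rho_exponent) ^+ 2 = (delta `^ - gain) ^+ 12 * (delta * delta `^ (- sigma)).
Proof.
rewrite -[X in _ = _ * (X * _)]powRr1 ?(ltW delta0)//.
rewrite -!powR_mulrn ?powR_ge0// -!powRrM -!powRD; try by rewrite (gt_eqF delta0) implybT.
congr powR; rewrite /gain /rho_exponent; field; have [s0 s1] := andP sigma01; lra.
Qed.
End Exponents.

Lemma le_of_expn (R : realDomainType) (D q K : R) (n : nat) :
  (0 < n)%N -> 0 <= D -> 1 <= q -> 0 <= K -> D ^+ n <= q * K ^+ n -> D <= q * K.
Proof.
move=> n0 D0 q1 K0 h.
have qK0 : 0 <= q * K by rewrite mulr_ge0// (le_trans ler01).
rewrite -(@ler_pXn2r _ n)// exprMn; apply: le_trans h _.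
by rewrite ler_wpM2r ?exprn_ge0// ler_eXnr.
Qed.

Theorem theorem1 (R : realType) :
  exists M : R, 0 <= M /\
  forall sigma c : R,
    0 < sigma < 1 ->
    c < sigma * (1 - sigma) / (4 * (7 + 3 * sigma)) ->
  exists kappa : R, 0 < kappa /\
  forall (delta C : R) (A : {fset R}),
    0 < delta < 1 ->
    0 < C ->
    [set` A] `<=` [set x : R | 1 <= x <= 2] ->
    separated_by delta [set` A] ->
    (#|` A|)%:R = delta `^ (- sigma) ->
    (forall (I : interval R) (l : R),
       itv_of_length I l -> delta <= l ->
       (#|` [fset x in A | x \in I]%fset|)%:R
         <= C * l `^ sigma * (#|` A|)%:R) ->
    ((kappa * C `^ (- M) * delta `^ (- c) * (#|` A|)%:R)%:E
      <= covering_number delta (sumset [set` A] [set` A])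
         + covering_number delta (productset [set` A] [set` A]))%E.
Proof.
exists 3; split => // sigma c sigma01 cgain.
(* The harmonic sum enters with the exponent 8, and its eighth power must cost at
   most delta^(c - gain). *)
pose e := (gain sigma - c) / 8.
have e0 : 0 < e by rewrite divr_gt0// subr_gt0.
pose q : R := 45 * 2 ^+ 38.
pose h0 : R := 1 + e^-1.
have h01 : 1 <= h0 by rewrite lerDl invr_ge0 ltW.
have q1 : 1 <= q by rewrite mulr_ege1// ?exprn_ege1// ?ler1n.
have qh0 : 0 < q * h0 ^+ 8 by rewrite mulr_gt0 ?exprn_gt0// (lt_le_trans ltr01).
exists (2 * (q * h0 ^+ 8))^-1; split; first by rewrite invr_gt0 mulr_gt0.
move=> delta C A delta01 C0 A12' Asep' Acard Afrost'.
have [delta0 delta1] := andP delta01.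
have [sigma0 sigma1] := andP sigma01.
have A12 x : x \in A -> 1 <= x <= 2 by move=> xA; apply: A12'.
have Asep x y : x \in A -> y \in A -> x != y -> delta <= `|x - y|.
  by move=> xA yA; apply: Asep'.
have Afrost : frostman delta sigma C A.
  move=> u l dl; apply: le_trans (Afrost' `[u, u + l] l _ dl); last by exists u, true, false.
  rewrite ler_nat; apply: fsubset_leq_card; apply/fsubsetP => x.
  by rewrite !inE.
have N0 : 0 < #|` A|%:R :> R by rewrite Acard powR_gt0.
have cA : (0 < #|` A|)%N by rewrite -(ltr0n R).
pose n1 := #|` sum_floor delta A|; pose n2 := #|` prod_floor delta A|.
have cov1 : ((n1%:R / 2)%:E <= covering_number delta (sumset [set` A] [set` A]))%E.
  apply: covering_number_ge_card => // _ /imfset2P[x /= xA [y /= yA ->]].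
  by exists (x + y) => //; exists x => //; exists y.
have cov2 : ((n2%:R / 2)%:E <= covering_number delta (productset [set` A] [set` A]))%E.
  apply: covering_number_ge_card => // _ /imfset2P[x /= xA [y /= yA ->]].
  by exists (x * y) => //; exists x => //; exists y.
apply: le_trans (leeD cov1 cov2); rewrite -EFinD lee_fin.
pose K : R := (n1%:R + n2%:R) / #|` A|%:R.
have KN : K * #|` A|%:R = n1%:R + n2%:R by rewrite divfK ?gt_eqF.
pose rho := delta `^ rho_exponent sigma.
have /andP[g0 g1] := rho_exponent_bounds sigma01.
have rhoP : delta <= rho <= 1.
  rewrite ger1_powR ?delta0 ?(ltW delta1)//=.
  by rewrite -[leRHS](powRr0 delta) ger_powR// delta0 ltW.
set ell := harmonic_sum R #|` A|.
have ell1 : 1 <= ell by apply: harmonic_sum_ge1.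
have C1 := frostman_constant_ge1 delta01 A12 Afrost Acard.
have K0 : 0 <= K by rewrite divr_ge0 ?addr_ge0.
set D := delta `^ - gain sigma.
have D0 : 0 < D by rewrite powR_gt0.
have DK : D <= q * (C ^+ 3 * ell ^+ 8) * K.
  have c1 : 1 <= q * (C ^+ 3 * ell ^+ 8).
    by rewrite mulr_ege1// mulr_ege1// exprn_ege1.
  have [|||h|h] := @discretised_dichotomy R delta sigma C A delta01 sigma01 C0 A12 Asep
      Afrost Acard K rho.
  - by rewrite KN lerDl.
  - by rewrite KN lerDr.
  - exact: rhoP.
  - rewrite -/ell -/q in h; apply: (@le_of_expn _ D _ K 14) => //; first exact: ltW.
    have := ler_wpM2l (exprn_ge0 14 (ltW D0)) h; rewrite mulr1 => h'.
    apply: le_trans h' _; rewrite mulrCA rho_powR_sigma// mulr1.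
    by rewrite le_eqVlt; apply/orP; left; apply/eqP; ring.
  - rewrite -/ell in h; apply: (@le_of_expn _ D _ K 12) => //; first exact: ltW.
    have dN : 0 < delta * #|` A|%:R by rewrite mulr_gt0.
    rewrite rho_sqr// -Acard ler_pM2r// in h.
    apply: le_trans h _; rewrite mulrA; apply: ler_wpM2r; first exact: exprn_ge0.
    have e1 : 90 * 2 ^+ 26 <= q.
      rewrite /q (_ : 90 * 2 ^+ 26 = 45 * 2 ^+ 27); last by rewrite exprS; ring.
      by rewrite ler_wpM2l// ler_weXn2l// ler1n.
    have e2 : C ^+ 1 * ell ^+ 4 <= C ^+ 3 * ell ^+ 8.
      have := @monomial_le R C ell 1 1 3 4 8 0 0 C1 ell1 (lexx 1) isT isT isT.
      by rewrite !expr0 !mulr1.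
    apply: ler_pM => //.
    by apply: mulr_ge0; apply: exprn_ge0; apply: le_trans ler01 _.
have ellle : ell ^+ 8 <= h0 ^+ 8 * delta `^ (c - gain sigma).
  have le1 : ell <= h0 * #|` A|%:R `^ e by apply: harmonic_sum_le_powR.
  have h00 : 0 <= h0 by apply: le_trans h01.
  apply: le_trans (_ : (h0 * #|` A|%:R `^ e) ^+ 8 <= _).
    rewrite lerXn2r ?nnegrE//; first exact: le_trans ler01 ell1.
    by rewrite mulr_ge0// powR_ge0.
  rewrite exprMn ler_wpM2l ?exprn_ge0//.
  rewrite Acard -powRrM -powR_mulrn ?powR_ge0// -powRrM.
  apply: ger_powR; first by rewrite delta0 ltW.
  have -> : - sigma * e * 8 = sigma * (c - gain sigma) by rewrite /e; field.
  rewrite -[leLHS]mul1r ler_wnM2r ?(ltW sigma1)//.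
  by rewrite subr_le0 ltW.
have final : delta `^ (- c) <= q * h0 ^+ 8 * C ^+ 3 * K.
  have -> : delta `^ (- c) = D * delta `^ (gain sigma - c).
    rewrite /D -powRD; last by rewrite (gt_eqF delta0) implybT.
    by rewrite addKr.
  have dc0 : 0 < delta `^ (gain sigma - c) by rewrite powR_gt0.
  apply: le_trans (ler_wpM2r (ltW dc0) DK) _.
  have q0 : 0 <= q * C ^+ 3 * K 
    by apply: mulr_ge0 => //; apply: mulr_ge0; [apply: le_trans ler01 q1|apply: exprn_ge0 (ltW C0)].
  have -> : q * (C ^+ 3 * ell ^+ 8) * K * delta `^ (gain sigma - c)
    = q * C ^+ 3 * K * (ell ^+ 8 * delta `^ (gain sigma - c)) by ring.
  have -> : q * h0 ^+ 8 * C ^+ 3 * K = q * C ^+ 3 * K * h0 ^+ 8 by ring.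
  rewrite ler_wpM2l//; apply: le_trans (ler_wpM2r (ltW dc0) ellle) _.
  rewrite -mulrA -powRD; last by rewrite (gt_eqF delta0) implybT.
  by rewrite (_ : _ + _ = 0) ?powRr0 ?mulr1//; ring.
have C30 : 0 < C ^+ 3 by rewrite exprn_gt0.
rewrite -[3]/(3%:R) powR_invn ?(ltW C0)//.
have -> : n1%:R / 2 + n2%:R / 2 = K * #|` A|%:R / 2 by rewrite KN mulrDl.
have -> : K * #|` A|%:R / 2 = 2^-1 * K * #|` A|%:R by ring.
rewrite ler_pM2r//.
have z0 : 0 <= (2 * (q * h0 ^+ 8))^-1 * C ^- 3.
  by rewrite mulr_ge0 ?invr_ge0 ?exprn_ge0 ?(ltW C0)// mulr_ge0// ltW.
apply: le_trans (ler_wpM2l z0 final) _.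
rewrite le_eqVlt; apply/orP; left; apply/eqP; field.
by rewrite (gt_eqF C0) /=; apply/andP; split; rewrite gt_eqF// (lt_le_trans ltr01).
Qed.
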